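(* Let $\mathcal{P}$ be a radical parametrization in $n$ parameters, given with a fixed representation as in the context, and let $\mathcal{A}_\mathcal{P}$, $\mathcal{B}_\mathcal{P}$, $\mathcal{V}_\mathcal{P}$ be its auxiliary, incidence and radical varieties. Then: (i) every irreducible component of $\mathcal{A}_\mathcal{P}$ has dimension $n$; (ii) $\mathcal{B}_\mathcal{P}$ is irreducible and has dimension $n$; (iii) $\mathcal{V}_\mathcal{P}$ is irreducible and has dimension $n$.
   Context: Let $\overline{t}=(t_1,\dots,t_n)$. A radical tower over $\mathbb{C}(\overline{t})$ is a tower of fields $\mathbb{F}_0=\mathbb{C}(\overline{t})\subseteq\mathbb{F}_1\subseteq\dots\subseteq\mathbb{F}_m$ with $\mathbb{F}_i=\mathbb{F}_{i-1}(\delta_i)$, where $\delta_i^{e_i}=\alpha_i\in\mathbb{F}_{i-1}$, $e_i\in\mathbb{N}$. A radical parametrization $\mathcal{P}$ is a tuple $\overline{x}=(x_1,\dots,x_r)$ of elements of $\mathbb{F}_m$, with $r>n$, whose Jacobian with respect to $\overline{t}$ (using the unique extensions of the derivations $\partial/\partial t_i$ to $\mathbb{F}_m$) has rank $n$; the $\delta_i$ are realized as analytic functions $\delta_i(\overline{t})$ by fixing values $\delta_i(\overline{t}_0)=a_i$ at some point $\overline{t}_0$ (choice of branches), so that $\overline{x}(\overline{t})$ is well defined. A representation of $\mathcal{P}$ consists of the tower together with polynomials such that $\alpha_1=\alpha_{1N}(\overline{t})/\alpha_{1D}(\overline{t})$, $\alpha_i=\alpha_{iN}(\overline{t},\delta_1,\dots,\delta_{i-1})/\alpha_{iD}(\overline{t},\delta_1,\dots,\delta_{i-1})$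 for $i=2,\dots,m$, and $x_j=x_{jN}(\overline{t},\overline{\delta})/x_{jD}(\overline{t},\overline{\delta})$ for $j=1,\dots,r$, where $\overline{\delta}=(\delta_1,\dots,\delta_m)$. Let $\varphi:\mathbb{C}^n\to\mathbb{C}^{n+m+r}$, $\overline{t}\mapsto(\overline{t},\overline{\delta}(\overline{t}),\overline{x}(\overline{t}))$. The incidence variety is $\mathcal{B}_\mathcal{P}=\overline{\mathrm{Im}(\varphi)}$ (Zariski closure). Let $\pi:\mathcal{B}_\mathcal{P}\to\mathbb{C}^r$, $(\overline{t},\overline{\delta},\overline{x})\mapsto\overline{x}$; the radical variety is $\mathcal{V}_\mathcal{P}=\overline{\pi(\mathcal{B}_\mathcal{P})}\subset\mathbb{C}^r$. In $\mathbb{C}[\overline{T},\overline{\Delta},\overline{X},Z]$ define $E_i=\Delta_i^{e_i}\alpha_{iD}(\overline{T},\Delta_1,\dots,\Delta_{i-1})-\alpha_{iN}(\overline{T},\Delta_1,\dots,\Delta_{i-1})$ ($i=1,\dots,m$), $G_j=X_jx_{jD}(\overline{T},\overline{\Delta})-x_{jN}(\overline{T},\overline{\Delta})$ ($j=1,\dots,r$), and $G_Z=Z\cdot\mathrm{lcm}(x_{1D},\dots,x_{rD},\alpha_{1D},\dots,\alpha_{mD})-1$. The auxiliary variety $\mathcal{A}_\mathcal{P}\subset\mathbb{C}^{n+m+r}$ is the Zariski closure of the projection of $V(E_1,\dots,E_m,G_1,\dots,G_r,G_Z)\subset\mathbb{C}^{n+m+r+1}$ forgetting the last coordinate $Z$.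 *)

(* Defs.v *)
From HB Require Import structures.
From mathcomp Require Import all_boot all_order all_algebra.
From mathcomp Require Import all_classical all_reals all_analysis.
From mathcomp Require Import complex.
From mathcomp Require mpoly.
Import (canonicals) mpoly.

Set Implicit Arguments.
Unset Strict Implicit.
Unset Printing Implicit Defensive.

Import Order.TTheory GRing.Theory Num.Theory.
Import numFieldNormedType.Exports.
Local Open Scope ring_scope.
Local Open Scope classical_set_scope.

Section Zariski.
Variables (K : comNzRingType) (N : nat).

Definition zero_set (S : set (mpoly.mpoly N K)) : set ('I_N -> K) :=
  [set v | forall p, S p -> mpoly.meval v p = 0].

Definition zclosed (A : set ('I_N -> K)) : Prop :=
  exists S, A = zero_set S.

Definition zclosure (A : set ('I_N -> K)) : set ('I_N -> K) :=
  [set v | forall B, zclosed B -> A `<=` B -> B v].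

Definition zirreducible (A : set ('I_N -> K)) : Prop :=
  [/\ zclosed A, A !=set0 &
      forall B1 B2, zclosed B1 -> zclosed B2 -> A = B1 `|` B2 ->
        A = B1 \/ A = B2].

Definition zcomponent (A Z : set ('I_N -> K)) : Prop :=
  [/\ zirreducible Z, Z `<=` A &
      forall Z', zirreducible Z' -> Z `<=` Z' -> Z' `<=` A -> Z' = Z].

Definition zdim_ge (A : set ('I_N -> K)) (k : nat) : Prop :=
  exists Z : nat -> set ('I_N -> K),
    (forall i, (i <= k)%N -> zirreducible (Z i) /\ Z i `<=` A) /\
    (forall i, (i < k)%N -> Z i `<=` Z i.+1 /\ Z i <> Z i.+1).

Definition zdim (A : set ('I_N -> K)) (d : nat) : Prop :=
  zdim_ge A d /\ ~ zdim_ge A d.+1.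

Definition mdvd (p q : mpoly.mpoly N K) : Prop := exists s, q = p * s.

Definition is_lcm (ps : seq (mpoly.mpoly N K)) (L : mpoly.mpoly N K) : Prop :=
  (forall p, p \in ps -> mdvd p L) /\
  (forall M, (forall p, p \in ps -> mdvd p M) -> mdvd L M).

Definition mvar (k : 'I_N) : mpoly.mpoly N K := @mpoly.mpolyX N K (mpoly.mnm1 k).

End Zariski.

Definition embed (K : comNzRingType) (M N : nat) (le : (M <= N)%N)
  (p : mpoly.mpoly M K) : mpoly.mpoly N K :=
  mpoly.comp_mpoly [tuple mvar K (widen_ord le k) | k < M] p.

(* Index bookkeeping.  Coordinates of C^(n+m+r+1) are (T, Delta, X, Z). *)
Lemma le_pref (n m : nat) (i : 'I_m) : (n + i <= n + m)%N.
Proof. by rewrite leq_add2l ltnW. Qed.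

Lemma le_trans_aux (a b c : nat) (h1 : (a <= b)%N) : (a <= b + c)%N.
Proof. exact: leq_trans h1 (leq_addr _ _). Qed.

Definition le_TD_all (n m r : nat) : (n + m <= n + m + r + 1)%N :=
  le_trans_aux 1 (le_trans_aux r (leqnn (n + m))).

Definition le_Di_all (n m r : nat) (i : 'I_m) : (n + i <= n + m + r + 1)%N :=
  le_trans_aux 1 (le_trans_aux r (@le_pref n m i)).

Definition idxDelta (n m r : nat) (i : 'I_m) : 'I_(n + m + r + 1) :=
  lshift 1 (lshift r (rshift n i)).
Definition idxX (n m r : nat) (j : 'I_r) : 'I_(n + m + r + 1) :=
  lshift 1 (rshift (n + m) j).
Definition idxZ (n m r : nat) : 'I_(n + m + r + 1) :=
  rshift (n + m + r) (@ord0 0).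

Arguments le_pref : clear implicits.
Arguments le_TD_all : clear implicits.
Arguments le_Di_all : clear implicits.
Arguments idxDelta : clear implicits.
Arguments idxX : clear implicits.
Arguments idxZ : clear implicits.

(* aN i, aD i : polynomials in (T, Delta_1..Delta_(i-1))  (n+i vars)   *)
(* xN j, xD j : polynomials in (T, Delta)                 (n+m vars)   *)
Section Radical.
Variables (R : realType) (n m r : nat).
Local Notation C := (R[i]).
Variables (e : 'I_m -> nat)
          (aN aD : forall i : 'I_m, mpoly.mpoly (n + i) C)
          (xN xD : 'I_r -> mpoly.mpoly (n + m) C).

Definition tdpoint (t : 'rV[C^o]_n) (d : 'I_m -> C) : 'I_(n + m) -> C :=
  fun a => match fintype.split a with inl k => t ord0 k | inr i => d i end.

Definition alphaN_at (v : 'I_(n + m) -> C) (i : 'I_m) : C :=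
  mpoly.meval v (embed (le_pref n m i) (aN i)).
Definition alphaD_at (v : 'I_(n + m) -> C) (i : 'I_m) : C :=
  mpoly.meval v (embed (le_pref n m i) (aD i)).

Definition holomorphic_on (U : set 'rV[C^o]_n) (f : 'rV[C^o]_n -> C) : Prop :=
  forall t, U t -> differentiable (f : 'rV[C^o]_n -> C^o) t.

Definition branch_realization (U : set 'rV[C^o]_n)
  (delta : 'I_m -> 'rV[C^o]_n -> C) : Prop :=
  [/\ open U, connected U, U !=set0,
      (forall i, holomorphic_on U (delta i)) &
      forall t, U t ->
        let v := tdpoint t (fun i => delta i t) in
        [/\ forall i, alphaD_at v i != 0,
            forall i, delta i t ^+ e i = alphaN_at v i / alphaD_at v i &
            forall j, mpoly.meval v (xD j) != 0]].

Definition xfun (delta : 'I_m -> 'rV[C^o]_n -> C) (j : 'I_r) (t : 'rV[C^o]_n) : C :=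
  let v := tdpoint t (fun i => delta i t) in
  mpoly.meval v (xN j) / mpoly.meval v (xD j).

Definition xjacobian (delta : 'I_m -> 'rV[C^o]_n -> C) (t0 : 'rV[C^o]_n) : 'M[C]_(r, n) :=
  \matrix_(j < r, k < n) ('D_(delta_mx 0 k) (xfun delta j : 'rV[C^o]_n -> C^o) t0 : C).

Definition phi (delta : 'I_m -> 'rV[C^o]_n -> C) (t : 'rV[C^o]_n) : 'I_(n + m + r) -> C :=
  fun k => match fintype.split k with
           | inl a => tdpoint t (fun i => delta i t) a
           | inr j => xfun delta j t
           end.

Definition incidence_variety (U : set 'rV[C^o]_n) (delta : 'I_m -> 'rV[C^o]_n -> C) :
  set ('I_(n + m + r) -> C) := zclosure (phi delta @` U).

Definition proj_x (w : 'I_(n + m + r) -> C) : 'I_r -> C :=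
  fun j => w (rshift (n + m) j).

Definition radical_variety (U : set 'rV[C^o]_n) (delta : 'I_m -> 'rV[C^o]_n -> C) :
  set ('I_r -> C) := zclosure (proj_x @` incidence_variety U delta).

Definition polE (i : 'I_m) : mpoly.mpoly (n + m + r + 1) C :=
  mvar C (idxDelta n m r i) ^+ e i * embed (le_Di_all n m r i) (aD i)
  - embed (le_Di_all n m r i) (aN i).
Definition polG (j : 'I_r) : mpoly.mpoly (n + m + r + 1) C :=
  mvar C (idxX n m r j) * embed (le_TD_all n m r) (xD j)
  - embed (le_TD_all n m r) (xN j).
Definition polGZ (L : mpoly.mpoly (n + m + r + 1) C) : mpoly.mpoly (n + m + r + 1) C :=
  mvar C (idxZ n m r) * L - 1.

Definition denominators : seq (mpoly.mpoly (n + m + r + 1) C) :=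
  [seq embed (le_TD_all n m r) (xD j) | j <- enum 'I_r] ++
  [seq embed (le_Di_all n m r i) (aD i) | i <- enum 'I_m].

Definition auxiliary_variety (L : mpoly.mpoly (n + m + r + 1) C) :
  set ('I_(n + m + r) -> C) :=
  zclosure ((fun w : 'I_(n + m + r + 1) -> C => fun k => w (lshift 1 k)) @`
    zero_set [set p | (exists i, p = polE i) \/ (exists j, p = polG j)
                      \/ p = polGZ L]).

End Radical.

Arguments branch_realization : clear implicits.
Arguments xjacobian : clear implicits.
Arguments incidence_variety : clear implicits.
Arguments radical_variety : clear implicits.
Arguments denominators : clear implicits.
Arguments auxiliary_variety : clear implicits.
Arguments is_lcm : clear implicits.
Arguments zcomponent : clear implicits.
Arguments zirreducible : clear implicits.
Arguments zdim : clear implicits.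

(* Main.v *)
Require Import Defs.
From HB Require Import structures.
From mathcomp Require Import all_boot all_order all_algebra.
From mathcomp Require Import boolp classical_sets.
From mathcomp Require Import spectral ring.
From mathcomp Require mpoly.
Import Order.TTheory GRing.Theory Num.Theory.

(** Let [W] be the set of points [(T, Delta, X)] satisfying the equations [E_i], [G_j] with all
    denominators nonzero.  On [W] every coordinate acts, through a matrix over [C(T)], on the finite
    family of monomials [Delta^beta]; denominators are inverted by Cayley-Hamilton.  Hence any [n + 1]
    functions on [W] are algebraically dependent, which bounds the dimension of an irreducible subset
    of the closure of [W] from above as soon as [T] is independent on it: a strict chain of
    irreducible closed sets produces one more independent function at each step.  Conversely, if
    [F_1, ..., F_k] are independent on an irreducible [Z] and the coordinates are algebraic over them,
    almost every point of [C^k] is hit by [Z], so that some slice [F_k = c] still carries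
    [F_1, ..., F_(k-1)] as independent functions, and a chain of length [k] is built by descent.

    (i) [T] is independent on each component, because a point of [W] can be moved to a nearby [T]
    by choosing nearby [e_i]-th roots: the part of [W] over [a(T) <> 0] is dense.
    (ii) A polynomial [h] in the branches satisfies [h^j * q(T, h) = 0] with [q(T, 0) <> 0]
    generically, so off a hypersurface its zero set is open and closed.  Since two points of a ball
    can be joined off a complex hypersurface, [h] vanishes on a connected open set as soon as it does
    near one point; only the continuity of the branches is used.
    (iii) If [A] is a left inverse of the Jacobian, the [n] linear forms [A X] have identity
    differential at [t0], which forces their independence. *)

Module AlgebraicPart.

Set Implicit Arguments.
Unset Strict Implicit.
Unset Printing Implicit Defensive.
Import mpoly.
Local Open Scope ring_scope.
Local Open Scope classical_set_scope.

(** * Noetherianity and irreducible components of Zariski closed sets *)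

Definition vanishes (K : comNzRingType) N (p : {mpoly K[N]}) (A : set ('I_N -> K)) :=
  forall w, A w -> p.@[w] = 0.

Section Noetherian.
Variable (N : nat).

(** Every tail of [f] attains its minimum. Choosing each time a minimizer of the tail that starts
    after the previous choice gives the subsequence. *)
Lemma nat_mono_subseq (f : nat -> nat) : exists phi : nat -> nat,
  (forall i j, (i < j)%N -> (phi i < phi j)%N) /\
  (forall i j, (i < j)%N -> (f (phi i) <= f (phi j))%N).
Proof.
have mi m : exists k, (m <= k)%N /\ forall l, (m <= l)%N -> (f k <= f l)%N.
  have ex : exists v, `[< exists2 k, (m <= k)%N & f k = v >].
    by exists (f m); apply/asboolP; exists m.
  case: (ex_minnP ex) => v /asboolP [k mk fk] vmin; exists k; split=> // l ml.
  by rewrite fk; apply: vmin; apply/asboolP; exists l.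
have [g gP] := choice mi.
pose phi := fix phi i := if i is j.+1 then g (phi j).+1 else g 0%N.
have phiS i : (phi i < phi i.+1)%N by rewrite /=; case: (gP (phi i).+1).
have phim i j : (i < j)%N -> (phi i < phi j)%N.
  elim: j => // j IH; rewrite ltnS leq_eqVlt => /orP[/eqP -> //|/IH h].
  exact: ltn_trans h (phiS j).
exists phi; split=> // i j ij.
case: i ij => [|i] ij /=; first by case: (gP 0%N) => _; apply.
case: (gP (phi i).+1) => _; apply; apply: phim; exact: ltn_trans ij.
Qed.

(** Induction on the number of coordinates: first a subsequence monotone in all coordinates but the
    last, then inside it one monotone in the last. *)
Lemma dickson_subseq n (f : nat -> 'I_n -> nat) : exists phi : nat -> nat,
  (forall i j, (i < j)%N -> (phi i < phi j)%N) /\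
  (forall i j k, (i < j)%N -> (f (phi i) k <= f (phi j) k)%N).
Proof.
elim: n f => [|n IH] f; first by exists id; split=> // i j [].
have [phi [phi1 phi2]] := IH (fun i k => f i (lift ord_max k)).
have [psi [psi1 psi2]] := nat_mono_subseq (fun i => f (phi i) ord_max).
exists (phi \o psi); split=> [i j ij|i j k ij]; first exact/phi1/psi1.
by case: (unliftP ord_max k) => [k' ->|->]; [exact/phi2/psi1 | exact: psi2].
Qed.

Variable (K : fieldType).
Implicit Types (A B Z : set ('I_N -> K)) (p q : {mpoly K[N]}).

Lemma zclosureP A v : zclosure A v <-> forall p, vanishes p A -> p.@[v] = 0.
Proof.
split=> [Av p pA|h B [S ->] AB p Sp].
  suff h : zero_set [set p] v by exact: h.
  by apply: Av => [|w Aw q ->]; [exists [set p] | exact: pA].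
by apply: h => w Aw; apply: (AB w Aw).
Qed.

Lemma zclosure_closed A : zclosed (zclosure A).
Proof.
exists [set p | vanishes p A]; apply/seteqP; split=> v.
  by move/zclosureP.
by move=> h; apply/zclosureP.
Qed.

Lemma subset_zclosure A : A `<=` zclosure A.
Proof. by move=> v Av; apply/zclosureP => p; apply. Qed.

Lemma zclosure_id A : zclosed A -> zclosure A = A.
Proof.
move=> cA; apply/seteqP; split; last exact: subset_zclosure.
by move=> v; apply.
Qed.

Lemma zclosedP A v : zclosed A -> (forall p, vanishes p A -> p.@[v] = 0) -> A v.
Proof. by move=> cA h; rewrite -(zclosure_id cA); apply/zclosureP. Qed.

Lemma zclosed_sep A v : zclosed A -> ~ A v ->
  exists2 p, vanishes p A & p.@[v] != 0.
Proof.
move=> cA nAv; apply: contrapT => h; apply: nAv; apply: zclosedP => // p pA.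
by apply/eqP; case: eqP => // /eqP pv; case: h; exists p.
Qed.

Lemma zclosure_vanishes A p : vanishes p A -> vanishes p (zclosure A).
Proof. by move=> pA v /zclosureP; apply. Qed.

Lemma zclosureS A B : zclosed B -> A `<=` B -> zclosure A `<=` B.
Proof. by move=> cB AB v; apply. Qed.

Lemma zclosed_poly p : zclosed [set w | p.@[w] = 0].
Proof.
exists [set p]; apply/seteqP; split=> w /=; first by move=> pw q ->.
by move=> h; apply: h.
Qed.

Lemma zclosedI A B : zclosed A -> zclosed B -> zclosed (A `&` B).
Proof.
move=> [S ->] [T ->]; exists (S `|` T); apply/seteqP; split=> w /=.
  by move=> [h1 h2] p [/h1|/h2].
by move=> h; split=> p Hp; apply: h; [left|right].
Qed.

Lemma zclosedU A B : zclosed A -> zclosed B -> zclosed (A `|` B).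
Proof.
move=> cA cB.
suff -> : A `|` B = zclosure (A `|` B) by exact: zclosure_closed.
apply/seteqP; split; first exact: subset_zclosure.
move=> w /zclosureP h; apply: contrapT => /not_orP [nA nB].
have [p pA pw] := zclosed_sep cA nA; have [q qB qw] := zclosed_sep cB nB.
have /eqP : (p * q).@[w] = 0.
  by apply: h => v [/pA|/qB] e; rewrite mevalM e ?mul0r ?mulr0.
by rewrite mevalM mulf_eq0 (negPf pw) (negPf qw).
Qed.

Lemma zclosed0 : zclosed (set0 : set ('I_N -> K)).
Proof.
exists [set 1]; apply/seteqP; split=> w //= /(_ 1 erefl) /eqP.
by rewrite meval1 oner_eq0.
Qed.

Lemma zirreducible_prime Z p q : zirreducible _ _ Z -> vanishes (p * q) Z ->
  vanishes p Z \/ vanishes q Z.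
Proof.
move=> [cZ _ irr] pq.
have [] := irr (Z `&` [set w | p.@[w] = 0]) (Z `&` [set w | q.@[w] = 0]).
- by apply: zclosedI => //; apply: zclosed_poly.
- by apply: zclosedI => //; apply: zclosed_poly.
- apply/seteqP; split=> w /=; last by case=> [[]|[]].
  move=> Zw; have /eqP := pq w Zw; rewrite mevalM mulf_eq0.
  by case/orP => /eqP e; [left|right].
- by move=> e; left=> w; rewrite e => -[].
- by move=> e; right=> w; rewrite e => -[].
Qed.

(** If the closure were the union of two proper closed sets, each would have an equation failing
    somewhere on [A], while the product of the two equations vanishes on [A]. *)
Lemma zirreducible_closure A : A !=set0 ->
  (forall p q, vanishes (p * q) A -> vanishes p A \/ vanishes q A) ->
  zirreducible _ _ (zclosure A).
Proof.
move=> [a Aa] pr; split; first exact: zclosure_closed.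
  by exists a; apply: subset_zclosure.
move=> B1 B2 c1 c2 e; apply: contrapT => /not_orP [n1 n2].
have sep B : zclosed B -> zclosure A <> B -> B `<=` zclosure A ->
    exists2 p, vanishes p B & ~ vanishes p A.
  move=> cB nB BA; apply: contrapT => h; apply: nB; apply/seteqP; split=> //.
  apply: zclosureS => // w Aw; apply: zclosedP => // p pB.
  by apply: contrapT => pw; apply: h; exists p => // /(_ w Aw).
have [|p pB npA] := sep B1 c1 n1.
  by rewrite e; left.
have [|q qB nqA] := sep B2 c2 n2; first by rewrite e; right.
case: (pr p q) => // w Aw; rewrite mevalM.
have : (B1 `|` B2) w by rewrite -e; apply: subset_zclosure.
by case=> [/pB|/qB] ->; rewrite ?mul0r ?mulr0.
Qed.

(* Otherwise take at each step an equation of [Z i.+1] failing on [Z i] with least leading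
   monomial; by Dickson's lemma some later one can be reduced by an earlier one. *)
Lemma zclosed_dcc (Z : nat -> set ('I_N -> K)) :
  (forall i, zclosed (Z i)) -> (forall i, Z i.+1 `<=` Z i) ->
  exists i, Z i.+1 = Z i.
Proof.
move=> cZ dZ; apply: contrapT => /forallNP nZ.
have dZl i j : (i <= j)%N -> Z j `<=` Z i.
  elim: j => [|j IH]; first by rewrite leqn0 => /eqP ->.
  rewrite leq_eqVlt => /orP[/eqP -> //|/IH h]; exact: subset_trans (dZ j) h.
pose Q i p := vanishes p (Z i.+1) /\ ~ vanishes p (Z i).
have Qmin i : exists p, Q i p /\ forall q, Q i q -> ~~ (mlead q < mlead p)%O.
  have [p0 Qp0] : exists p, Q i p.
    apply: contrapT => h; apply: (nZ i); apply/seteqP; split=> // v Zv.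
    apply: zclosedP => // p pZ; apply: contrapT => pv; apply: h.
    by exists p; split=> // /(_ v Zv).
  move: {2}(mlead p0) (erefl (mlead p0)) => m; elim/(well_founded_ind (@ltom_wf N)): m p0 Qp0.
  move=> m IH p Qp em; case: (pselect (exists q, Q i q /\ (mlead q < mlead p)%O)).
    by move=> [q [Qq lt]]; apply: (IH (mlead q) _ q) => //; rewrite -em.
  by move=> h; exists p; split=> // q Qq; apply/negP => lt; apply: h; exists q.
have [p pP] := choice Qmin.
have [phi [phi1 phi2]] := dickson_subseq (fun i => fun k => mlead (p i) k).
pose i := phi 0%N; pose j := phi 1%N.
have ij : (i < j)%N by exact: phi1.
have leij : (mlead (p i) <= mlead (p j))%MM.
  by apply/mnm_lepP => k; apply: phi2.
have [[pi1 pi2] _] := pP i; have [[pj1 pj2] minj] := pP j.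
have nz k : p k != 0.
  by apply/eqP => e; case: (pP k) => -[_ +] _; rewrite e; apply=> w _; rewrite meval0.
(* [t] is the multiple of [p i] with the leading term of [p j]. Since [p i] vanishes on [Z i.+1],
   which contains [Z j], the difference [p j - t] still separates [Z j.+1] from [Z j], with a
   smaller leading monomial. *)
pose c := mleadc (p j) / mleadc (p i).
pose t : {mpoly K[N]} := c *: ('X_[mlead (p j) - mlead (p i)] * p i).
have c0 : c != 0 by rewrite mulf_neq0 ?invr_eq0 ?mleadc_eq0.
have X0 (m : 'X_{1..N}) : ('X_[m] : {mpoly K[N]}) != 0.
  by rewrite -mleadc_eq0 mleadXm mcoeffX eqxx oner_eq0.
have lt : mlead t = mlead (p j).
  by rewrite mleadZ // mleadM // mleadXm submK.
have ct : t@_(mlead (p j)) = mleadc (p j).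
  rewrite -{1}lt /t mleadZ // mleadcZ mleadM // mleadcM mleadXm mcoeffX eqxx mul1r /c.
  by rewrite mulfVK // mleadc_eq0.
have Qq : Q j (p j - t).
  have pi0 w : Z j w -> (p i).@[w] = 0 by move=> Zw; apply/pi1/(dZl i.+1 j).
  split=> [w Zw|h].
    by rewrite mevalB mevalZ mevalM pj1 // pi0 ?mulr0 ?subr0 //; exact: dZ.
  apply: pj2 => w Zw; move: (h w Zw).
  by rewrite mevalB mevalZ mevalM pi0 // !mulr0 subr0.
have /negP := minj _ Qq; apply.
have q0 : p j - t != 0.
  by apply/eqP => e; case: Qq => _; rewrite e; apply=> w _; rewrite meval0.
rewrite lt_neqAle; apply/andP; split.
  apply/eqP => e; have := mleadc_eq0 (p j - t).
  by rewrite (negPf q0) e mcoeffB ct subrr eqxx.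
by apply: le_trans (mleadB_le _ _) _; rewrite lt joinxx.
Qed.

(** Otherwise every candidate contains a strictly smaller one, and iterating a choice function
    contradicts [zclosed_dcc]. *)
Lemma zclosed_min (P : set ('I_N -> K) -> Prop) A :
  zclosed A -> P A -> exists M, [/\ zclosed M, P M, M `<=` A &
    forall B, zclosed B -> P B -> B `<=` M -> B = M].
Proof.
move=> cA PA; apply: contrapT => nM.
pose T := {M : set ('I_N -> K) | [/\ zclosed M, P M & M `<=` A]}.
have next (M : T) : exists M' : T, sval M' `<=` sval M /\ sval M' <> sval M.
  case: M => M [cM PM MA] /=; apply: contrapT => h; apply: nM.
  exists M; split=> // B cB PB BM; apply: contrapT => nB; apply: h.
  by exists (exist _ B (And3 cB PB (subset_trans BM MA))).
have [g gP] := choice next.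
pose A0 : T := exist _ A (And3 cA PA (fun x (h : A x) => h)).
pose Z i := sval (iter i g A0).
have [i|i|i] := @zclosed_dcc Z.
- by rewrite /Z; case: (iter i g A0) => M [].
- by rewrite /Z iterS; case: (gP (iter i g A0)).
- by rewrite /Z iterS; case: (gP (iter i g A0)).
Qed.

Definition zunion (s : seq (set ('I_N -> K))) : set ('I_N -> K) :=
  foldr setU set0 s.

Lemma zunion_cat s t : zunion (s ++ t) = zunion s `|` zunion t.
Proof. by elim: s => [|B s IH] /=; rewrite ?set0U // IH setUA. Qed.

(** Noetherian induction: a minimal counterexample is neither empty nor irreducible, so it splits
    into two proper closed subsets that both decompose. The list may be redundant. *)
Lemma zclosed_decomposition A : zclosed A ->
  exists2 s, (forall i, (i < size s)%N -> zirreducible _ _ (nth set0 s i)) &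
    A = zunion s.
Proof.
move=> cA; apply: contrapT => nA.
pose P B := ~ exists2 s,
  (forall i, (i < size s)%N -> zirreducible _ _ (nth set0 s i)) & B = zunion s.
have [M [cM nM _ minM]] := @zclosed_min P A cA nA.
apply: (nM).
have dec B : zclosed B -> B `<=` M -> B <> M ->
  exists2 s, (forall i, (i < size s)%N -> zirreducible _ _ (nth set0 s i)) &
    B = zunion s.
  by move=> cB BM nBM; apply: contrapT => h; apply: nBM; apply: minM.
case: (pselect (zirreducible _ _ M)) => [irr|nirr].
  by exists [:: M]; [case | rewrite /= setU0].
case: (pselect (M !=set0)) => [M0|/nonemptyPn M0]; last by exists [::].
suff [B1 [B2 [c1 c2 e n1 n2]]] : exists B1 B2,
    [/\ zclosed B1, zclosed B2, M = B1 `|` B2, M <> B1 & M <> B2].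
  have [|s irs es] := dec B1 c1 _ (nesym n1); first by rewrite e; left.
  have [|t irt et] := dec B2 c2 _ (nesym n2); first by rewrite e; right.
  exists (s ++ t) => [i|]; last by rewrite zunion_cat -es -et.
  rewrite size_cat nth_cat; case: (ltnP i (size s)) => [lt _|le lt]; first exact: irs.
  by apply: irt; rewrite ltn_subLR.
apply: contrapT => h; apply: nirr; split=> // B1 B2 c1 c2 e.
by apply: contrapT => /not_orP [n1 n2]; apply: h; exists B1, B2.
Qed.

Lemma zirreducible_sub_union Z s : zirreducible _ _ Z ->
  (forall i, (i < size s)%N -> zclosed (nth set0 s i)) -> Z `<=` zunion s ->
  exists2 i, (i < size s)%N & Z `<=` nth set0 s i.
Proof.
move=> [cZ [z Zz] irr]; elim: s => [|B s IH] cs ZU; first by case: (ZU z).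
have cB : zclosed B := cs 0%N isT.
have cU : zclosed (zunion s).
  elim: s cs {IH ZU} => [|D s IH] cs /=; first exact: zclosed0.
  apply: zclosedU; first exact: (cs 1%N).
  by apply: IH => -[//|i] lt; apply: (cs i.+2).
case: (irr (Z `&` B) (Z `&` zunion s)); [exact: zclosedI|exact: zclosedI|..].
- by rewrite -setIUr; apply/esym/setIidl.
- by move=> e; exists 0%N => // w; rewrite e => -[].
- move=> e; have [||i lt Zi] := IH; last by exists i.+1.
    by move=> i lt; apply: (cs i.+1).
  by move=> w; rewrite e => -[].
Qed.

(** Discard from a decomposition of the closure of [S] the pieces on which [a] vanishes. By density
    the remaining ones still cover [S], so one of them contains [Z], and equals it by maximality. *)
Lemma zcomponent_generic (S Z : set ('I_N -> K)) (a : {mpoly K[N]}) :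
  zcomponent K N (zclosure S) Z ->
  (forall p, vanishes p (S `&` [set w | a.@[w] != 0]) -> vanishes p S) ->
  ~ vanishes a Z.
Proof.
move=> [irrZ ZS maxZ] dense aZ.
have [s irs es] := zclosed_decomposition (zclosure_closed S).
pose s' := [seq B <- s | ~~ `[< vanishes a B >]].
have s'P i : (i < size s')%N ->
    exists2 j, (j < size s)%N & nth set0 s' i = nth set0 s j /\ ~ vanishes a (nth set0 s j).
  rewrite /s' {s' dense es ZS}; elim: s irs i => [|B s IH] irs i //=.
  have IH' := IH (fun i lt => irs i.+1 lt).
  case: ifP => [/asboolPn nB|_]; last by move=> /IH' [j lt h]; exists j.+1.
  case: i => [|i] /=; first by exists 0%N.
  by move=> /IH' [j lt h]; exists j.+1.
have cs' i : (i < size s')%N -> zclosed (nth set0 s' i).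
  by move=> /s'P [j lt [-> _]]; case: (irs j lt).
have Ss' w : zunion s w -> a.@[w] != 0 -> zunion s' w.
  rewrite /s' {irs es s'P cs' dense ZS s'}; elim: s => [|B s IH] //= h aw.
  case: ifP => [_|/negbT]; first by case: h => [Bw|/IH h]; [left|right; apply: h].
  by rewrite negbK => /asboolP aB; case: h => [/aB /eqP|/IH]; [rewrite (negPf aw)|apply].
have cU : zclosed (zunion s').
  move: cs'; elim: s' {s'P Ss'} => [|D s' IH] cs /=; first exact: zclosed0.
  apply: zclosedU; first exact: (cs 0%N).
  by apply: IH => i lt; apply: (cs i.+1).
have SU : zclosure S `<=` zunion s'.
  apply: zclosureS => // w Sw; apply: zclosedP => // p pU.
  apply: (dense p _ w Sw) => v [Sv av]; apply: pU; apply: Ss' => //.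
  by rewrite -es; apply: subset_zclosure.
have [i lt Zi] := zirreducible_sub_union irrZ cs' (subset_trans ZS SU).
have [j ltj [e na]] := s'P i lt; rewrite e in Zi.
have sub t k : (k < size t)%N -> nth set0 t k `<=` zunion t.
  elim: t k => [|B t IH] k; first by rewrite ltn0.
  by case: k => [|k] ltk w h; [left | right; apply: (IH k)].
have e2 : nth set0 s j = Z.
  by apply: maxZ => //; [exact: irs | rewrite es; apply: sub].
by apply: na; rewrite e2.
Qed.

End Noetherian.

(** * Functions acting through a matrix over a function field *)

Section MpolyEval.

Lemma mpoly_ring_ind (K : comNzRingType) n (P : {mpoly K[n]} -> Prop) :
  (forall c, P c%:MP) -> (forall i, P 'X_i) ->
  (forall p q, P p -> P q -> P (p + q)) ->
  (forall p q, P p -> P q -> P (p * q)) -> forall p, P p.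
Proof.
move=> PC PX PD PM p.
elim/mpolyind: p => [|c m p _ _ Pp]; first by rewrite -mpolyC0.
apply: (PD) => //; rewrite -mul_mpolyC; apply: (PM) => //.
rewrite mpolyXE_id; apply: (big_ind P) => [||i _]; [by rewrite -mpolyC1 | exact: PM |].
by elim: (m i) => [|j IH]; [rewrite expr0 -mpolyC1 | rewrite exprS; apply: (PM)].
Qed.

(** The new coordinate comes last because [muni] singles out the last variable. *)
Definition ext_ord (T : Type) n (u : 'I_n -> T) (x : T) : 'I_n.+1 -> T :=
  fun i => if unlift ord_max i is Some j then u j else x.

Lemma ext_ord_max T n (u : 'I_n -> T) x : ext_ord u x ord_max = x.
Proof. by rewrite /ext_ord unlift_none. Qed.

Lemma ext_ord_widen T n (u : 'I_n -> T) x i :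
  ext_ord u x (widen_ord (leqnSn n) i) = u i.
Proof.
have -> : widen_ord (leqnSn n) i = lift ord_max i.
  by apply/val_inj; rewrite /= /bump leqNgt ltn_ord.
by rewrite /ext_ord liftK.
Qed.

Lemma ext_ordE T n (v : 'I_n.+1 -> T) :
  v = ext_ord (fun i => v (widen_ord (leqnSn n) i)) (v ord_max).
Proof.
apply/funext => i; rewrite /ext_ord; case: unliftP => [j ->|-> //].
by congr v; apply/val_inj; rewrite /= /bump leqNgt ltn_ord.
Qed.

Variable (K : comNzRingType).

Lemma meval_muni n (p : {mpoly K[n.+1]}) (u : 'I_n -> K) x :
  p.@[ext_ord u x] = (map_poly (meval u) (muni p)).[x].
Proof.
rewrite [in LHS](mpolyE p) muniE !raddf_sum /= horner_sum.
apply: eq_bigr => m _; rewrite mevalZ mevalX big_ord_recr /= ext_ord_max.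
rewrite map_polyZ /= map_polyXn hornerZ hornerXn mevalZ mevalX mulrA.
congr (_ * _ * _); apply: eq_bigr => i _.
by rewrite ext_ord_widen mnmE.
Qed.

Lemma muni_eq0 n (p : {mpoly K[n.+1]}) : (muni p == 0) = (p == 0).
Proof.
apply/eqP/eqP => [h|->]; last by rewrite muni0.
apply/mpolyP => m0; rewrite mcoeff0; apply/eqP; rewrite -[_ == _]negbK -mcoeff_msupp.
apply/negP => m0p; move: h; rewrite muniE => /(congr1 (fun q : {poly {mpoly K[n]}} => q`_(m0 ord_max))).
rewrite coef0 coef_sum => /(congr1 (mcoeff [multinom (m0 (widen_ord (leqnSn n) i)) | i < n])).
rewrite mcoeff0 raddf_sum /= (bigD1_seq m0) ?msupp_uniq //= big1 => [|m nm].
  rewrite addr0 coefZ coefXn eqxx mulr1 mcoeffZ mcoeffX eqxx mulr1 => /eqP.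
  by apply/negP; rewrite -mcoeff_msupp.
rewrite coefZ coefXn; case: eqP => [e|_]; last by rewrite mulr0 mcoeff0.
rewrite mulr1 mcoeffZ mcoeffX; case: eqP => [e'|_]; last by rewrite mulr0.
case/eqP: nm; apply/mnmP => i; rewrite (ext_ordE m) (ext_ordE m0) /ext_ord.
case: unliftP => [j _|_]; last by rewrite e.
by move/mnmP: e' => /(_ j); rewrite !mnmE.
Qed.

Definition comp_fam n k (F : 'I_n -> {mpoly K[k]}) : {mpoly K[n]} -> {mpoly K[k]} :=
  comp_mpoly [tuple F i | i < n].

Lemma comp_famE n k (F : 'I_n -> {mpoly K[k]}) p w :
  (comp_fam F p).@[w] = p.@[fun i => (F i).@[w]].
Proof.
by rewrite /comp_fam comp_mpoly_meval; apply: meval_eq => i; rewrite tnth_mktuple.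
Qed.

End MpolyEval.

(** Induction on the number of variables: keep the leading coefficient in the last variable nonzero,
    then move the last coordinate off finitely many roots. *)
Lemma mpoly_neq0_near (K : numFieldType) n (p : {mpoly K[n]}) (v : 'I_n -> K) e :
  p != 0 -> 0 < e -> exists2 u, (forall i, `|u i - v i| < e) & p.@[u] != 0.
Proof.
elim: n p v => [|n IH] p v p0 e0.
  exists v => [[]//|]; apply: contraNneq p0; rewrite (nvar0_mpolyC p) mevalC => ->.
  by rewrite mpolyC0.
have := p0; rewrite -muni_eq0 -lead_coef_eq0 => l0.
have [u uv ul] := IH _ (fun i => v (widen_ord (leqnSn n) i)) l0 e0.
set q := map_poly (meval u) (muni p).
have q0 : q != 0.
  apply: contraNneq ul => /(congr1 (fun r : {poly K} => r`_(size (muni p)).-1)).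
  by rewrite coef_map coef0 /= -lead_coefE => ->.
(* Infinitely many candidates; the denominator starts at 2, so that each is at distance strictly
   less than [e]. *)
pose x (i : nat) := v ord_max + e / i.+2%:R.
have xinj : injective x.
  move=> i j /addrI /(mulfI (lt0r_neq0 e0)) /invr_inj /eqP.
  by rewrite eqr_nat => /eqP [].
have [i xi] : exists i, q.[x i] != 0.
  apply: contrapT => /forallNP h.
  have := @max_poly_roots _ q [seq x i | i <- iota 0 (size q)] q0.
  rewrite size_map size_iota ltnn map_inj_uniq // iota_uniq.
  suff -> : all (root q) [seq x i | i <- iota 0 (size q)] by move=> /(_ isT isT).
  by apply/allP => _ /mapP [i _ ->]; apply/rootP/eqP; move: (h i) => /negP; rewrite negbK.
exists (ext_ord u (x i)) => [j|]; last by rewrite meval_muni.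
rewrite (ext_ordE v) /ext_ord; case: unliftP => [l _|_]; first exact: uv.
rewrite /x addrAC subrr add0r normrM gtr0_norm // normfV ger0_norm ?ler0n //.
by rewrite ltr_pdivrMr ?ltr0n // ltr_pMr // ltr1n.
Qed.

Section Fin.
Variables (K : fieldType) (X : Type) (k : nat) (S : set X) (f : X -> 'I_k -> K).
Implicit Types (a b : {mpoly K[k]}) (h y : X -> K).

(* [b h] acts on the span of the family [g] through the matrix [P] with entries in [K[f]]. *)
Definition finb (J : finType) (g : J -> X -> K) b h :=
  exists P : J -> J -> {mpoly K[k]}, forall w, S w -> forall i,
    b.@[f w] * h w * g i w = \sum_j (P i j).@[f w] * g j w.

Definition fin (J : finType) (g : J -> X -> K) h :=
  exists2 b, b != 0 & finb g b h.

Definition algebraic_over h := exists2 Q : {poly {mpoly K[k]}}, Q != 0 &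
  forall w, S w -> (map_poly (meval (f w)) Q).[h w] = 0.

Section Closure.
Variables (J : finType) (g : J -> X -> K).

Lemma finb_mulr b c h : finb g b h -> finb g (b * c) h.
Proof.
move=> [P hP]; exists (fun i j => P i j * c) => w Sw i.
transitivity (c.@[f w] * (b.@[f w] * h w * g i w)); first by rewrite mevalM; ring.
rewrite hP // mulr_sumr; apply: eq_bigr => j _.
by rewrite mevalM; ring.
Qed.

Lemma fin_common (I : finType) (h : I -> X -> K) : (forall i, fin g (h i)) ->
  exists2 b, b != 0 & forall i, finb g b (h i).
Proof.
move=> /(_ _)/cid2 hb; pose b i := s2val (hb i).
exists (\prod_i b i) => [|i].
  by apply/prodf_neq0 => i _; apply: (s2valP (hb i)).
by rewrite (bigD1 i) //=; apply: finb_mulr; apply: (s2valP' (hb i)).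
Qed.

Lemma fin_meval q : fin g (fun w => q.@[f w]).
Proof.
exists 1; first exact: oner_neq0.
exists (fun i j => if i == j then q else 0) => w Sw i.
rewrite (bigD1 i) //= eqxx big1 ?addr0 ?meval1 ?mul1r // => j /negPf.
by rewrite eq_sym => ->; rewrite meval0 mul0r.
Qed.

Lemma finD h1 h2 : fin g h1 -> fin g h2 -> fin g (fun w => h1 w + h2 w).
Proof.
move=> [b1 n1 f1] [b2 n2 f2]; exists (b1 * b2); first exact: mulf_neq0.
have [P1 e1] := finb_mulr b2 f1; have [P2] := finb_mulr b1 f2.
rewrite (mulrC b2) => e2; exists (fun i j => P1 i j + P2 i j) => w Sw i.
rewrite mulrDr mulrDl e1 // e2 // -big_split /=.
by apply: eq_bigr => j _; rewrite mevalD mulrDl.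
Qed.

Lemma finM h1 h2 : fin g h1 -> fin g h2 -> fin g (fun w => h1 w * h2 w).
Proof.
move=> [b1 n1 [P1 e1]] [b2 n2 [P2 e2]]; exists (b1 * b2); first exact: mulf_neq0.
exists (fun i l => \sum_j P1 i j * P2 j l) => w Sw i.
transitivity (b2.@[f w] * h2 w * (b1.@[f w] * h1 w * g i w)).
  by rewrite mevalM; ring.
rewrite e1 // mulr_sumr.
under eq_bigr => j _ do rewrite mulrCA e2 // mulr_sumr.
rewrite exchange_big /=; apply: eq_bigr => l _; rewrite raddf_sum mulr_suml /=.
by apply: eq_bigr => j _; rewrite mevalM mulrA.
Qed.

Lemma fin_div a h h' : a != 0 -> fin g h' ->
  (forall w, S w -> a.@[f w] * h w = h' w) -> fin g h.
Proof.
move=> a0 [b b0 [P e]] ah; exists (b * a); first exact: mulf_neq0.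
by exists P => w Sw i; rewrite mevalM -e // -ah // mulrA.
Qed.

Lemma fin_ext h h' : fin g h' -> (forall w, S w -> h w = h' w) -> fin g h.
Proof.
move=> hh' e; apply: (@fin_div 1) hh' _; first exact: oner_neq0.
by move=> w Sw; rewrite meval1 mul1r e.
Qed.

Lemma fin_horner (Q : {poly {mpoly K[k]}}) h : fin g h ->
  fin g (fun w => (map_poly (meval (f w)) Q).[h w]).
Proof.
move=> hh; elim/poly_ind: Q => [|Q c IH].
  by apply: fin_ext (fin_meval 0) _ => w _; rewrite rmorph0 horner0 meval0.
apply: fin_ext (finD (finM IH hh) (fin_meval c)) _ => w _.
by rewrite rmorphD rmorphM /= map_polyX map_polyC /= !hornerE.
Qed.

Lemma fin_mpoly n (F : 'I_n -> X -> K) (p : {mpoly K[n]}) :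
  (forall i, fin g (F i)) -> fin g (fun w => p.@[fun i => F i w]).
Proof.
move=> hF; elim/mpoly_ring_ind: p => [c|i|p q hp hq|p q hp hq].
- by apply: fin_ext (fin_meval c%:MP) _ => w _; rewrite !mevalC.
- by apply: fin_ext (hF i) _ => w _; rewrite mevalXU.
- by apply: fin_ext (finD hp hq) _ => w _; rewrite mevalD.
- by apply: fin_ext (finM hp hq) _ => w _; rewrite mevalM.
Qed.

(* Cayley-Hamilton: [b h] is an eigenvalue of the matrix [P] at every point, with eigenvector [g]. *)
Lemma fin_algebraic j0 h : (forall w, S w -> g j0 w != 0) -> fin g h ->
  algebraic_over h.
Proof.
move=> g0 [b b0 [P e]].
pose A : 'M[{mpoly K[k]}]_#|J| := \matrix_(i, j) P (enum_val j) (enum_val i).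
exists (char_poly A \Po (b *: 'X)).
  rewrite comp_poly_eq0 ?size_scale ?size_polyX //.
  exact/monic_neq0/char_poly_monic.
move=> w Sw; rewrite map_comp_poly /= horner_comp map_char_poly map_polyZ /= map_polyX.
rewrite hornerZ hornerX; apply/rootP; rewrite -eigenvalue_root_char.
apply/eigenvalueP; exists (\row_i g (enum_val i) w); last first.
  apply/eqP => /rowP /(_ (enum_rank j0)); rewrite !mxE enum_rankK => /eqP.
  by rewrite (negPf (g0 w Sw)).
apply/rowP => j; rewrite !mxE e // (reindex _ (onW_bij _ (@enum_val_bij J))) /=.
by apply: eq_bigr => i _; rewrite !mxE mulrC.
Qed.

End Closure.

(** The largest power of the variable is factored out of [Q]. At points where [h] is nonzero, the
    cofactor alone gives a relation with nonzero constant term. *)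
Lemma algebraic_over_unit_cst h : algebraic_over h ->
  exists Q : {poly {mpoly K[k]}}, exists2 m, Q`_0 != 0 &
  forall w, S w -> h w ^+ m * (map_poly (meval (f w)) Q).[h w] = 0.
Proof.
move=> [Q Q0 e]; have [m [Q' + eQ]] := multiplicity_XsubC Q 0.
rewrite Q0 /= => r; exists Q', m; first by rewrite -horner_coef0.
move=> w Sw; rewrite -(e w Sw) eQ subr0 rmorphM rmorphXn /= map_polyX.
by rewrite hornerM hornerXn mulrC.
Qed.

(** Cancelling the power of [h] leaves [Q]_0 + h * Q1(h) = 0[, so that]Q[_0 / h = - Q1(h)], and the
    right-hand side acts on the family. *)
Lemma fin_inv (J : finType) (g : J -> X -> K) j0 h :
  (forall w, S w -> g j0 w != 0) -> fin g h -> (forall w, S w -> h w != 0) ->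
  fin g (fun w => (h w)^-1).
Proof.
move=> g0 hh h0; have [Q [m Q0 e]] := algebraic_over_unit_cst (fin_algebraic g0 hh).
pose Q'' := Q %/ 'X.
have := @poly_ind {mpoly K[k]} (fun Q => exists Q1, Q = Q1 * 'X + (Q`_0)%:P).
case/(_ _ _ Q) => [|p c _|Q1 eQ].
- by exists 0; rewrite mul0r coef0 addr0.
- by exists p; rewrite coefD coefMX coefC eqxx add0r.
have h1 := finM (fin_meval g (-1)) (fin_horner Q1 hh).
apply: fin_div Q0 h1 _ => w Sw.
have := e w Sw; move/eqP; rewrite mulf_eq0 expf_eq0 (negPf (h0 w Sw)) andbF /=.
rewrite [in X in X -> _]eQ rmorphD rmorphM /= map_polyX map_polyC /= !hornerE.
rewrite addrC addr_eq0 => /eqP ->; rewrite mevalN meval1.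
by rewrite mulNr mulfK ?h0 // mulN1r.
Qed.

(** The new family consists of the products of the [g j] with the powers of [y] below the degree of
    the relation. *)
Lemma fin_adjoin (J : finType) (g : J -> X -> K) (j0 : J) y e (c : 'I_e -> X -> K) a :
  (forall w, S w -> g j0 w = 1) -> (0 < e)%N -> a != 0 -> (forall l, fin g (c l)) ->
  (forall w, S w -> a.@[f w] * y w ^+ e = \sum_l c l w * y w ^+ l) ->
  exists (J' : finType) (g' : J' -> X -> K) (j1 : J'),
    [/\ forall w, S w -> g' j1 w = 1, fin g' y & forall h, fin g h -> fin g' h].
Proof.
case: e c => // e c g0 _ a0 /fin_common [b b0 /(_ _)/cid hc] ey.
pose P l := sval (hc l).
pose g' (jl : J * 'I_e.+1) w := g jl.1 w * y w ^+ jl.2.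
exists (J * 'I_e.+1)%type, g', (j0, ord0); split.
- by move=> w Sw; rewrite /g' expr0 mulr1 g0.
- exists (a * b); first exact: mulf_neq0.
  (* Multiplication by [y] shifts the exponent, except at the top exponent [e], where the relation
     rewrites [y ^+ e.+1]. *)
  exists (fun il jl : J * 'I_e.+1 => if (il.2 < e)%N
                       then (if (il.1 == jl.1) && (jl.2 == il.2.+1 :> nat) then a * b else 0)
                       else P jl.2 il.1 jl.1).
  move=> w Sw [i l]; rewrite /g' /=; case: ltnP => le.
    rewrite (bigD1 (i, Ordinal (le : l.+1 < e.+1)%N)) //= !eqxx /= big1 ?addr0.
      by rewrite exprS; ring.
    move=> [j l'] /= nj; case: andP => [[/eqP ej /eqP el]|_]; last by rewrite meval0 mul0r.
    by case/eqP: nj; rewrite ej; congr pair; apply/val_inj.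
  have el : l = e :> nat by apply/eqP; rewrite eqn_leq le -ltnS ltn_ord.
  transitivity (b.@[f w] * g i w * (a.@[f w] * y w ^+ e.+1)).
    by rewrite el exprS mevalM; ring.
  rewrite ey // mulr_sumr -(pair_bigA _ (fun j l' => (P l' i j).@[f w] * (g j w * y w ^+ l'))) /=.
  rewrite exchange_big /=; apply: eq_bigr => l' _.
  transitivity (b.@[f w] * c l' w * g i w * y w ^+ l'); first by ring.
  rewrite (svalP (hc l')) // mulr_suml; apply: eq_bigr => j _.
  by rewrite mulrA.
move=> h [b' b'0 [P' e']]; exists b' => //.
exists (fun il jl : J * 'I_e.+1 => if jl.2 == il.2 then P' il.1 jl.1 else 0) => w Sw [i l].
rewrite /g' /= mulrA e' // mulr_suml.
rewrite -(pair_bigA _ (fun j l' => (if l' == l then P' i j else 0).@[f w] * (g j w * y w ^+ l'))) /=.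
apply: eq_bigr => j _; rewrite (bigD1 l) //= eqxx big1 ?addr0 ?mulrA //.
by move=> l' /negPf ->; rewrite meval0 mul0r.
Qed.

End Fin.

(** * Algebraic dependence *)

Section Indep.
Variables (K : fieldType) (X : Type) (k : nat) (S : set X) (f : X -> 'I_k -> K).
Implicit Types (a b : {mpoly K[k]}) (h y : X -> K).

Definition alg_indep := forall q : {mpoly K[k]}, (forall w, S w -> q.@[f w] = 0) -> q = 0.

Lemma horner_map_sum (R R' : nzRingType) (phi : {additive R -> R'}) (Q : {poly R}) x :
  (map_poly phi Q).[x] = \sum_(i < size Q) phi Q`_i * x ^+ i.
Proof.
rewrite (@horner_coef_wide _ (size Q)); last exact: size_poly.
by apply: eq_bigr => i _; rewrite coef_map.
Qed.

(** The functions are adjoined one at a time, the leading coefficient of each relation serving as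
    denominator. *)
Lemma fin_of_algebraic N (y : 'I_N -> X -> K) : alg_indep ->
  (forall i, algebraic_over S f (y i)) ->
  exists (J : finType) (g : J -> X -> K) (j0 : J),
    (forall w, S w -> g j0 w = 1) /\ forall i, fin S f g (y i).
Proof.
move=> ind; elim: N y => [|N IH] y ya.
  by exists unit, (fun _ _ => 1), tt; split=> // -[].
have [J [g [j0 [g0 gy]]]] := IH (fun i => y (lift ord0 i)) (fun i => ya (lift ord0 i)).
have [Q Q0 eQ] := ya ord0.
(* A nonzero constant [Q] would be a relation between the components of [f]. *)
have sQ : (0 < (size Q).-1)%N.
  rewrite -subn1 subn_gt0 ltnNge; apply/negP => /size1_polyC e.
  move: Q0; rewrite e polyC_eq0 => /eqP; apply; apply: ind => w Sw.
  by rewrite -(eQ w Sw) [in RHS]e map_polyC hornerC.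
have eQ1 : (size Q).-1.+1 = size Q by rewrite prednK ?size_poly_gt0.
have := @fin_adjoin K X k S f J g j0 (y ord0) (size Q).-1
  (fun l w => (- Q`_l).@[f w]) (lead_coef Q) g0 sQ.
case; first by rewrite lead_coef_eq0.
- by move=> l; apply: fin_meval.
- move=> w Sw; apply/eqP; rewrite -subr_eq0; apply/eqP.
  rewrite -[RHS](eQ w Sw) horner_map_sum -eQ1 big_ord_recr /= [RHS]addrC -lead_coefE.
  congr (_ + _); rewrite -sumrN; apply: eq_bigr => l _.
  by rewrite mevalN mulNr opprK.
move=> J' [g' [j1 [g1 h1 h2]]]; exists J', g', j1; split=> // i.
by case: (unliftP ord0 i) => [j|] ->; [apply/h2/gy | apply: h1].
Qed.

(** Take a free subfamily of largest cardinality, nonempty because [g j0] is the constant 1. Any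
    other [g i] enters a relation with nonzero coefficient [c i], and the product of the [c i] is a
    common denominator. Freeness makes the matrix of a function unique. *)
Lemma fin_basis (J : finType) (g : J -> X -> K) (j0 : J) : alg_indep ->
  (forall w, S w -> g j0 w = 1) ->
  exists (D : nat) (g' : 'I_D.+1 -> X -> K),
    (forall a : 'I_D.+1 -> {mpoly K[k]},
        (forall w, S w -> \sum_i (a i).@[f w] * g' i w = 0) -> forall i, a i = 0) /\
    forall h, fin S f g h -> fin S f g' h.
Proof.
move=> ind g0.
pose free (I : {set J}) := `[< forall a : J -> {mpoly K[k]},
  (forall w, S w -> \sum_(j in I) (a j).@[f w] * g j w = 0) ->
  forall j, j \in I -> a j = 0 >].
have free0 : free [set j0]%SET.
  apply/asboolP => a ha j /set1P ->; apply: ind => w Sw.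
  by have := ha w Sw; rewrite big_set1 g0 // mulr1.
case: (arg_maxnP (fun I : {set J} => #|I|) free0) => I /asboolP fI maxI.
have I0 : (0 < #|I|)%N by have := maxI _ free0; rewrite cards1.
have expr_i i : exists (c : {mpoly K[k]}) (A : J -> {mpoly K[k]}), c != 0 /\ forall w, S w ->
    c.@[f w] * g i w = \sum_(j in I) (A j).@[f w] * g j w.
  case: (boolP (i \in I)) => iI.
    exists 1, (fun j => if j == i then 1 else 0); split=> [|w Sw]; first exact: oner_neq0.
    rewrite (bigD1 i) //= eqxx big1 ?addr0 // => j /andP[_ /negPf ->].
    by rewrite meval0 mul0r.
  have : ~ free (i |: I)%SET.
    by move=> /maxI; rewrite /= cardsU1 iI add1n ltnn.
  move=> /(contra_not (@asboolT _)) /existsNP [a /not_implyP [ha /existsNP [j /not_implyP [jI aj]]]].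
  have sumE w : \sum_(j in (i |: I)%SET) (a j).@[f w] * g j w =
      (a i).@[f w] * g i w + \sum_(j in I) (a j).@[f w] * g j w.
    by rewrite big_setU1.
  exists (a i), (fun j => - a j); split=> [|w Sw].
    apply/eqP => ai0; apply: aj; move: jI; rewrite in_setU1 => /orP[/eqP -> //|].
    by apply: fI => w Sw; have := ha w Sw; rewrite sumE ai0 meval0 mul0r add0r.
  have /eqP := ha w Sw; rewrite sumE addr_eq0 => /eqP ->; rewrite -sumrN.
  by apply: eq_bigr => l _; rewrite mevalN mulNr.
have [c /choice [A cAP]] := choice expr_i.
have c0 i : c i != 0 by case: (cAP i).
have cA i w : S w -> (c i).@[f w] * g i w = \sum_(j in I) (A i j).@[f w] * g j w.
  by case: (cAP i) => _; apply.
have cardI : #|I|.-1.+1 = #|I| by rewrite prednK.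
pose en (i : 'I_#|I|.-1.+1) : J := enum_val (cast_ord cardI i).
have sumI (F : J -> K) : \sum_(j in I) F j = \sum_i F (en i).
  rewrite big_enum_val (reindex (cast_ord cardI)) //=.
  by exists (cast_ord (esym cardI)) => i _; rewrite ?cast_ordK ?cast_ordKV.
exists #|I|.-1, (fun i => g (en i)); split.
  move=> a ha i.
  pose a' j := \sum_(i | en i == j) a i.
  have en_inj : injective en by move=> i1 i2 /enum_val_inj /cast_ord_inj.
  have a'E l : a' (en l) = a l.
    rewrite /a' (big_pred1 l) // => l'; exact: inj_eq.
  rewrite -a'E; apply: fI; last by rewrite /en enum_valP.
  by move=> w Sw; rewrite sumI -[RHS](ha w Sw); apply: eq_bigr => l _; rewrite a'E.
pose c' := \prod_j c j; pose A' i j := (\prod_(j' | j' != i) c j') * A i j.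
have cA' i w : S w -> c'.@[f w] * g i w = \sum_(j in I) (A' i j).@[f w] * g j w.
  move=> Sw; rewrite /c' (bigD1 i) //= mulrC mevalM mulrA (mulrC (g i w)) cA //.
  rewrite mulrC mulr_sumr; apply: eq_bigr => j _.
  by rewrite mevalM mulrA.
move=> h [b b0 [P e]]; exists (b * c').
  by rewrite mulf_neq0 //; apply/prodf_neq0.
exists (fun i l => \sum_j P (en i) j * A' j (en l)) => w Sw i.
transitivity (c'.@[f w] * (b.@[f w] * h w * g (en i) w)); first by rewrite mevalM; ring.
rewrite e // mulr_sumr.
under eq_bigr => j _ do rewrite mulrCA cA' // sumI mulr_sumr.
rewrite exchange_big /=; apply: eq_bigr => l _; rewrite raddf_sum mulr_suml /=.
by apply: eq_bigr => j _; rewrite mulrA [in RHS]mevalM.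
Qed.


Lemma card_bmultinom_le D : (#|{: 'X_{1..k < D}}| <= D ^ k)%N.
Proof.
have mi (m : 'X_{1..k < D}) i : (m i < D)%N.
  apply: leq_ltn_trans (bmdeg m); rewrite mdegE (bigD1 i) //=; exact: leq_addr.
pose F' (m : 'X_{1..k < D}) : {ffun 'I_k -> 'I_D} := [ffun i => Ordinal (mi m i)].
have Finj : injective F'.
  move=> m1 m2 /ffunP e; apply/val_inj/mnmP => i /=.
  by have := e i; rewrite !ffunE => /(congr1 val).
by have := leq_card F' Finj; rewrite card_ffun !card_ord.
Qed.

Lemma exists_left_kernel m1 m2 (A : 'M[K]_(m1, m2)) : (m2 < m1)%N ->
  exists2 u : 'rV_m1, u != 0 & u *m A = 0.
Proof.
move=> lt; exists (nz_row (kermx A)); last first.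
  by apply/sub_kermxP; apply: nz_row_sub.
rewrite nz_row_eq0 kermx_eq0 /row_free; apply/eqP => e.
by have := rank_leq_col A; rewrite e leqNgt lt.
Qed.

(* Counting: the monomials of degree at most [s] in each of the [k+1] functions [F i] number
   [(s+1)^(k+1)], but they lie in a space of dimension [O(s^k)]. *)
Lemma fin_dependent (J : finType) (g : J -> X -> K) j0 (F : 'I_k.+1 -> X -> K) :
  (forall w, S w -> g j0 w = 1) -> (forall l, fin S f g (F l)) ->
  exists (G : {mpoly K[k.+1]}) (b : {mpoly K[k]}),
    [/\ G != 0, b != 0 & forall w, S w -> b.@[f w] * G.@[fun l => F l w] = 0].
Proof.
move=> g0 /fin_common [b b0 /(_ _)/cid hF].
pose P l := sval (hF l); have eP l := svalP (hF l).
pose d := maxn (msize b) (\max_l \max_i \max_j msize (P l i j)).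
have db : (msize b <= d)%N by rewrite leq_maxl.
have dP l i j : (msize (P l i j) <= d)%N.
  rewrite leq_max; apply/orP; right.
  apply: leq_trans (leq_bigmax l); apply: leq_trans (leq_bigmax i).
  exact: (leq_bigmax j).
(* [R t h] bounds degrees: [b ^+ t * h] acts through a matrix whose entries have degree at most
   [t * d.+1]. *)
pose R t h := exists p : J -> J -> {mpoly K[k]},
  (forall i j, (msize (p i j) <= (t * d.+1).+1)%N) /\
  forall w, S w -> forall i, b.@[f w] ^+ t * h w * g i w = \sum_j (p i j).@[f w] * g j w.
have msizeM' (t : nat) (p q : {mpoly K[k]}) : (msize p <= (t * d.+1).+1)%N ->
    (msize q <= d)%N -> (msize (p * q) <= (t.+1 * d.+1).+1)%N.
  move=> hp hq; apply: leq_trans (msizeM_le p q) _.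
  by rewrite ltnS mulSn addnC (leq_trans (leq_add hq hp)) // addSn addnS.
have R0 : R 0%N (fun=> 1).
  exists (fun i j => if j == i then 1 else 0); split=> [i j|w Sw i].
    by case: eqP; rewrite ?msize1 ?msize0.
  rewrite (bigD1 i) //= eqxx big1 ?addr0 ?meval1 ?mulr1 // => j /negPf ->.
  by rewrite meval0 mul0r.
have Rpad t h : R t h -> R t.+1 h.
  move=> [p [sp ep]]; exists (fun i j => p i j * b); split=> [i j|w Sw i].
    exact: msizeM'.
  transitivity (b.@[f w] * (b.@[f w] ^+ t * h w * g i w)); first by rewrite exprS; ring.
  by rewrite ep // mulr_sumr; apply: eq_bigr => j _; rewrite mevalM; ring.
have RF t h l : R t h -> R t.+1 (fun w => h w * F l w).
  move=> [p [sp ep]]; exists (fun i j => \sum_j' p i j' * P l j' j); split=> [i j|w Sw i].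
    apply: leq_trans (mmeasure_sum _ _ _ _) _.
    by apply/bigmax_leqP => j' _; apply: msizeM'.
  transitivity (b.@[f w] * F l w * (b.@[f w] ^+ t * h w * g i w)); first by rewrite exprS; ring.
  rewrite ep // mulr_sumr.
  under eq_bigr => j _ do rewrite mulrCA eP // mulr_sumr.
  rewrite exchange_big /=; apply: eq_bigr => j _; rewrite raddf_sum mulr_suml /=.
  by apply: eq_bigr => j' _; rewrite mulrA [in RHS]mevalM.
have RX t h l c : R t h -> R (t + c)%N (fun w => h w * F l w ^+ c).
  move=> Rh; elim: c => [|c [p [sp ep]]].
    by case: Rh => p [sp ep]; exists p; rewrite addn0; split=> // w Sw i; rewrite mulr1 ep.
  have [p' [sp' ep']] := RF _ _ l (ex_intro _ p (conj sp ep)).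
  exists p'; rewrite addnS; split=> // w Sw i.
  by rewrite -ep' // (exprSr (F l w)) !mulrA.
have Rprod n (E : 'I_n -> 'I_k.+1) (c : 'I_n -> nat) :
    R (\sum_i c i)%N (fun w => \prod_i F (E i) w ^+ c i).
  elim: n E c => [|n IH] E c.
    case: R0 => p [sp ep]; exists p; rewrite big_ord0; split=> // w Sw i.
    by rewrite big_ord0 ep.
  have [p [sp ep]] := RX _ _ (E ord_max) (c ord_max)
    (IH (fun i => E (widen_ord (leqnSn n) i)) (fun i => c (widen_ord (leqnSn n) i))).
  by exists p; rewrite big_ord_recr; split=> // w Sw i; rewrite big_ord_recr /= -ep.
have Rpad' t t' h : R t h -> R (t' + t)%N h.
  by move=> Rt; elim: t' => [//|t' IH]; rewrite addSn; apply: Rpad.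
(* With this [s], the number of equations is at most [#|J| * D ^ k <= s * s.+1 ^ k], which is less
   than the number [s.+1 ^ k.+1] of unknowns. *)
pose s := (#|J| * (k.+1 * d.+1).+1 ^ k)%N.
pose T := (k.+1 * s)%N; pose D := (T * d.+1).+1.
have RT (beta : {ffun 'I_k.+1 -> 'I_s.+1}) : R T (fun w => \prod_i F i w ^+ beta i).
  have leT : (\sum_i beta i <= T)%N.
    have -> : T = (\sum_(i < k.+1) s)%N by rewrite sum_nat_const card_ord.
    by apply: leq_sum => i _; rewrite -ltnS.
  by rewrite -(subnK leT); apply: Rpad'; apply: (Rprod _ id).
have [p pP] := choice RT.
(* Only row [j0] matters: since [g j0] is 1, this row expresses the monomial itself in the family
   [g]. *)
pose A := \matrix_(i < #|{ffun 'I_k.+1 -> 'I_s.+1}|, j < #|{: J * 'X_{1..k < D}}|)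
   (p (enum_val i) j0 (enum_val j).1)@_((enum_val j).2).
have exp_le m n l : (m <= n)%N -> (m ^ l <= n ^ l)%N.
  by move=> h; elim: l => // l IH; rewrite !expnS leq_mul.
have [|u u0 uA] := exists_left_kernel A.
  rewrite card_prod card_ffun !card_ord expnS.
  apply: leq_ltn_trans (leq_mul (leqnn _) (card_bmultinom_le D)) _.
  have leD : (D <= (k.+1 * d.+1).+1 * s.+1)%N.
    rewrite /D /T mulnAC mulSn addSn ltnS.
    apply: (@leq_trans (k.+1 * d.+1 * s.+1)); last exact: leq_addl.
    by rewrite leq_mul2l leqnSn orbT.
  apply: (@leq_ltn_trans (s * s.+1 ^ k)); last by rewrite ltn_pmul2r // expn_gt0.
  rewrite /s -mulnA leq_mul2l -expnMn; apply/orP; right.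
  exact: exp_le.
pose mon (beta : {ffun 'I_k.+1 -> 'I_s.+1}) := [multinom (beta i : nat) | i < k.+1].
have mon_inj : injective mon.
  move=> b1 b2 /mnmP e; apply/ffunP => i; apply/val_inj.
  by have := e i; rewrite !mnmE.
pose G : {mpoly K[k.+1]} := \sum_i u ord0 i *: 'X_[mon (enum_val i)].
exists G, (b ^+ T); split.
- apply: contra_neq u0 => G0; apply/rowP => i; rewrite mxE.
  have := congr1 (mcoeff (mon (enum_val i))) G0; rewrite mcoeff0 raddf_sum /= => <-.
  rewrite (bigD1 i) //= mcoeffZ mcoeffX eqxx mulr1 big1 ?addr0 // => j ji.
  by rewrite mcoeffZ mcoeffX (inj_eq mon_inj) (inj_eq enum_val_inj) (negPf ji) mulr0.
- exact: expf_neq0.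
move=> w Sw; rewrite rmorphXn /= raddf_sum mulr_sumr /=.
transitivity (\sum_i u ord0 i * \sum_j (p (enum_val i) j0 j).@[f w] * g j w).
  apply: eq_bigr => i _; rewrite mevalZ mulrCA; congr (_ * _).
  case: (pP (enum_val i)) => _ <- //; rewrite g0 // mulr1 mevalX.
  by congr (_ * _); apply: eq_bigr => l _; rewrite mnmE.
under eq_bigr => i _ do rewrite mulr_sumr.
rewrite exchange_big big1 //= => j _.
suff e0 : \sum_i u ord0 i *: p (enum_val i) j0 j = 0.
  transitivity ((\sum_i u ord0 i *: p (enum_val i) j0 j).@[f w] * g j w).
    by rewrite raddf_sum mulr_suml; apply: eq_bigr => i _; rewrite /= mevalZ mulrA.
  by rewrite e0 meval0 mul0r.
apply/mpolyP => m; rewrite mcoeff0 raddf_sum /=.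
case: (ltnP (mdeg m) D) => mD.
  move/rowP: uA => /(_ (enum_rank (j, BMultinom mD))); rewrite !mxE => uA0.
  rewrite -[RHS]uA0; apply: eq_bigr => i _.
  by rewrite mxE enum_rankK mcoeffZ.
rewrite big1 // => i _; rewrite mcoeffZ memN_msupp_eq0 ?mulr0 //.
apply: msize_mdeg_ge; apply: leq_trans mD.
by case: (pP (enum_val i)).
Qed.

End Indep.

(** * Dimension and algebraic independence *)

Definition evalf (K : comNzRingType) N k (F : 'I_k -> {mpoly K[N]}) :
  ('I_N -> K) -> 'I_k -> K := fun w l => (F l).@[w].

Lemma meval_horner_comp (K : comNzRingType) N k (F : 'I_k -> {mpoly K[N]})
    (Q : {poly {mpoly K[k]}}) p w :
  ((map_poly (comp_fam F) Q).[p]).@[w] = (map_poly (meval (evalf F w)) Q).[p.@[w]].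
Proof.
rewrite -horner_map -map_poly_comp; congr (_.[_]); apply: eq_map_poly => s /=.
by rewrite comp_famE.
Qed.

Section Dominant.
Variables (K : numClosedFieldType) (N : nat).

(* Over a generic point [t], a common eigenvector of the commuting matrices by which the
   coordinates act on a basis of the function ring gives a point of [Z] above [t]. *)
Lemma generic_fibre_nonempty k (Z : set ('I_N -> K)) (F : 'I_k -> {mpoly K[N]}) :
  zclosed Z -> alg_indep Z (evalf F) ->
  (forall i, algebraic_over Z (evalf F) (fun w => w i)) ->
  exists2 B : {mpoly K[k]}, B != 0 &
    forall t, B.@[t] != 0 -> exists2 w, Z w & evalf F w = t.
Proof.
move=> cZ ind alg; set f := evalf F.
have [J [g0 [j0 [g01 gy]]]] := fin_of_algebraic ind alg.
have [D [g [gind finS]]] := fin_basis ind g01.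
have [B B0 /(_ _)/cid hR] := fin_common (fun i => finS _ (gy i)).
exists B => // t Bt.
pose R i : 'M[{mpoly K[k]}]_D.+1 := \matrix_(a, b) sval (hR i) a b.
have eR i w : Z w -> forall a, B.@[f w] * w i * g a w = \sum_b (R i a b).@[f w] * g b w.
  by move=> Zw a; rewrite (svalP (hR i)) //; apply: eq_bigr => b _; rewrite mxE.
have mx0 (M : 'M[{mpoly K[k]}]_D.+1) :
    (forall w, Z w -> forall a, \sum_b (M a b).@[f w] * g b w = 0) -> M = 0.
  move=> h; apply/matrixP => a b; rewrite mxE.
  by apply: (gind (fun b => M a b)) => w Zw; apply: h.
have eM (c1 c2 : ('I_N -> K) -> K) (M1 M2 : 'M[{mpoly K[k]}]_D.+1) :
    (forall w, Z w -> forall a, c1 w * g a w = \sum_b (M1 a b).@[f w] * g b w) ->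
    (forall w, Z w -> forall a, c2 w * g a w = \sum_b (M2 a b).@[f w] * g b w) ->
    forall w, Z w -> forall a,
      c1 w * c2 w * g a w = \sum_b ((M1 *m M2) a b).@[f w] * g b w.
  move=> h1 h2 w Zw a; rewrite mulrAC h1 // mulr_suml.
  under eq_bigr => b _ do rewrite mulrAC -mulrA h2 // mulr_sumr.
  rewrite exchange_big /=; apply: eq_bigr => b _; rewrite mxE raddf_sum mulr_suml /=.
  by apply: eq_bigr => l _; rewrite mulrA [in RHS]mevalM.
(* Both products represent multiplication by [B ^+ 2 * w i * w j], and the family is free. *)
have Rcomm i j : R i *m R j = R j *m R i.
  apply/subr0_eq/mx0 => w Zw a.
  have h1 := eM _ _ _ _ (eR i) (eR j) w Zw a.
  have h2 := eM _ _ _ _ (eR j) (eR i) w Zw a.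
  under eq_bigr => b _ do rewrite !mxE mevalB mulrBl.
  rewrite sumrB; apply/eqP; rewrite subr_eq0; apply/eqP.
  have := h1; rewrite [_ * _ * (_ * _)]mulrC h2 => e.
  rewrite [LHS](_ : _ = \sum_b ((R i *m R j) a b).@[f w] * g b w); last first.
    by apply: eq_bigr => b _; rewrite mxE.
  by rewrite -e; apply: eq_bigr => b _; rewrite !mxE.
pose Rt i : 'M[K]_D.+1 := map_mx (meval t) (R i).
have [|v v0 /allP vR] := @common_eigenvector K D.+1 [seq Rt i | i <- enum 'I_N] isT.
  move=> _ _ /mapP [i _ ->] /mapP [j _ ->].
  by rewrite /comm_mx /Rt -!map_mxM Rcomm.
have vRi i : exists l, v *m Rt i = l *: v.
  by apply/sub_rVP; apply: vR; apply: map_f; rewrite mem_enum.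
have [lam lamP] := choice vRi.
(* [R i] represents [B] times the coordinate, hence the division of the eigenvalue. *)
pose w0 i := lam i / B.@[t].
(* Evaluating [p] at [w0] is reading an eigenvalue: a matrix of [B ^+ d * p], specialized at [t],
   acts on [v] by the value of this product at [t] and [w0]. *)
have rep (p : {mpoly K[N]}) : exists d (M : 'M[{mpoly K[k]}]_D.+1),
    (forall w, Z w -> forall a,
       (B.@[f w] ^+ d * p.@[w]) * g a w = \sum_b (M a b).@[f w] * g b w) /\
    v *m map_mx (meval t) M = (B.@[t] ^+ d * p.@[w0]) *: v.
  elim/mpoly_ring_ind: p => [c|i|p q [d1 [M1 [e1 v1]]] [d2 [M2 [e2 v2]]]|
    p q [d1 [M1 [e1 v1]]] [d2 [M2 [e2 v2]]]].
  - exists 0%N, (c%:MP%:M); split=> [w Zw a|].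
      rewrite mul1r (bigD1 a) //= big1 => [|b /negPf ba].
        by rewrite mxE eqxx mulr1n !mevalC addr0.
      by rewrite mxE eq_sym ba mulr0n meval0 mul0r.
    by rewrite map_scalar_mx /= mul_mx_scalar mul1r !mevalC.
  - exists 1%N, (R i); split=> [w Zw a|]; first by rewrite expr1 mevalXU eR.
    by rewrite expr1 mevalXU lamP /w0 mulrC divfK.
  - exists (d1 + d2)%N, (B ^+ d2 *: M1 + B ^+ d1 *: M2); split=> [w Zw a|].
      transitivity (B.@[f w] ^+ d2 * (B.@[f w] ^+ d1 * p.@[w] * g a w) +
                    B.@[f w] ^+ d1 * (B.@[f w] ^+ d2 * q.@[w] * g a w)).
        by rewrite mevalD exprD; ring.
      rewrite e1 // e2 // !mulr_sumr -big_split /=; apply: eq_bigr => b _.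
      by rewrite !mxE mevalD !mevalM !rmorphXn /=; ring.
    rewrite map_mxD !map_mxZ mulmxDr -!scalemxAr v1 v2 !scalerA -scalerDl.
    by rewrite mevalD exprD !rmorphXn /=; congr (_ *: _); ring.
  - exists (d1 + d2)%N, (M1 *m M2); split=> [w Zw a|].
      rewrite -(eM _ _ _ _ e1 e2 w Zw a) mevalM exprD; ring.
    rewrite map_mxM mulmxA v1 -scalemxAl v2 scalerA mevalM exprD.
    by congr (_ *: _); ring.
(* If [p] is a function of [F] on [Z], its matrix is scalar. The case [q = 0] puts [w0] in [Z], and
   [p = F l] puts it above [t]. *)
have val (p : {mpoly K[N]}) (q : {mpoly K[k]}) :
    (forall w, Z w -> p.@[w] = q.@[f w]) -> p.@[w0] = q.@[t].
  move=> pq; have [d [M [e ev]]] := rep p.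
  have eMq : M = (B ^+ d * q)%:M.
    apply/subr0_eq/mx0 => w Zw a.
    under eq_bigr => b _ do rewrite !mxE mevalB mulrBl.
    rewrite sumrB -e // pq // (bigD1 a) //= big1 => [|b /negPf ba].
      by rewrite eqxx mulr1n mevalM rmorphXn /= addr0 subrr.
    by rewrite eq_sym ba mulr0n meval0 mul0r.
  move: ev; rewrite eMq map_scalar_mx /= mul_mx_scalar mevalM rmorphXn /=.
  move/eqP; rewrite -subr_eq0 -scalerBl scaler_eq0 (negPf v0) orbF subr_eq0.
  by move/eqP/(mulfI (expf_neq0 d Bt)).
exists w0.
  apply: zclosedP => // p pZ; rewrite (val p 0) ?meval0 // => w Zw.
  by rewrite meval0 pZ.
apply/funext => l; rewrite /f /evalf (val _ 'X_l) ?mevalXU // => w Zw.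
by rewrite mevalXU.
Qed.

Definition slice k (c : K) : {mpoly K[k.+1]} -> {mpoly K[k]} :=
  horner_eval (c%:MP) \o @muni k K.

HB.instance Definition _ k c := GRing.RMorphism.on (@slice k c).

Lemma meval_slice k c (p : {mpoly K[k.+1]}) u : (slice c p).@[u] = p.@[ext_ord u c].
Proof.
by rewrite meval_muni /slice /= /horner_eval -horner_map /= mevalC.
Qed.

Lemma slice_neq0 k (p : {mpoly K[k.+1]}) : p != 0 -> exists c, slice c p != 0.
Proof.
move=> p0; have [u _ pu] := mpoly_neq0_near (fun=> 0) p0 ltr01.
exists (u ord_max); apply: contraNneq pu => e.
by rewrite (ext_ordE u) -meval_slice e meval0.
Qed.

(* Below [Z] we put a minimal closed subset of a slice [F_k = c] on which the other [F_i]
   remain independent: by minimality it is irreducible. *)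
Lemma zdim_ge_alg_indep k (Z : set ('I_N -> K)) (F : 'I_k -> {mpoly K[N]}) :
  zirreducible K N Z -> alg_indep Z (evalf F) ->
  (forall i, algebraic_over Z (evalf F) (fun w => w i)) -> zdim_ge Z k.
Proof.
elim: k Z F => [|k IH] Z F irrZ ind alg.
  by exists (fun=> Z); split=> [i _|i]; [split | rewrite ltn0].
have cZ : zclosed Z by case: irrZ.
have [B B0 fib] := generic_fibre_nonempty cZ ind alg.
pose Q i := s2val (cid2 (alg i)).
have Q0 i : Q i != 0 := s2valP (cid2 (alg i)).
have QE i w (Zw : Z w) := s2valP' (cid2 (alg i)) w Zw.
(* Such a [c] keeps almost all fibres over the slice nonempty and keeps the relations of the
   coordinates nonzero. *)
have [c] : exists c, slice c (B * \prod_i lead_coef (Q i)) != 0.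
  apply: slice_neq0; rewrite mulf_neq0 //; apply/prodf_neq0 => i _.
  by rewrite lead_coef_eq0.
rewrite rmorphM rmorph_prod mulf_eq0 negb_or => /andP[Bc /prodf_neq0 Qc].
pose F' i := F (widen_ord (leqnSn k) i).
have fF w : evalf F w = ext_ord (evalf F' w) ((F ord_max).@[w]).
  by rewrite [LHS]ext_ordE.
pose Y := Z `&` [set w | (F ord_max - c%:MP).@[w] = 0].
have YF w : Y w -> evalf F w = ext_ord (evalf F' w) c.
  move=> [_ /= /eqP]; rewrite mevalB mevalC subr_eq0 => /eqP e.
  by rewrite fF e.
have cY : zclosed Y by apply: zclosedI => //; apply: zclosed_poly.
(* Where both [q] and the slice of [B] are nonzero, a point of [Z] lies above [(u, c)]; it belongs
   to [Y] and [q] does not vanish there. *)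
have indY : alg_indep Y (evalf F').
  move=> q qY; apply/eqP; apply: contraT => q0.
  have [u _] := mpoly_neq0_near (fun=> 0) (mulf_neq0 q0 Bc) ltr01.
  rewrite mevalM meval_slice mulf_eq0 negb_or => /andP[qu Bu].
  have [w Zw ew] := fib _ Bu.
  have Yw : Y w.
    split=> //=; rewrite mevalB mevalC.
    have /(congr1 (fun h => h ord_max)) := ew; rewrite ext_ord_max /evalf => ->.
    by rewrite subrr.
  case/eqP: qu; rewrite -(qY w Yw); congr (meval _ q); apply/funext => i.
  by rewrite /evalf /F' -[RHS]/(evalf F w _) ew ext_ord_widen.
have [M [cM indM MY minM]] := @zclosed_min _ _ (fun A => alg_indep A (evalf F')) _ cY indY.
have irrM : zirreducible K N M.
  split=> //.
    apply/set0P; apply/eqP => M0.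
    have /eqP : (1 : {mpoly K[k]}) = 0 by apply: indM => w; rewrite M0.
    by rewrite oner_eq0.
  move=> B1 B2 c1 c2 e; apply: contrapT => /not_orP [n1 n2].
  have dep A : zclosed A -> A `<=` M -> M <> A ->
      exists2 q, q != 0 & forall w, A w -> q.@[evalf F' w] = 0.
    move=> cA AM nA; apply: contrapT => h; apply: nA; apply/esym/minM => //.
    by move=> q qA; apply/eqP; apply: contraT => q0; case: h; exists q.
  have [|q1 q10 h1] := dep _ c1 _ n1; first by rewrite e; left.
  have [|q2 q20 h2] := dep _ c2 _ n2; first by rewrite e; right.
  have /eqP : q1 * q2 = 0.
    by apply: indM => w; rewrite e mevalM => -[/h1|/h2] ->; rewrite ?mul0r ?mulr0.
  by rewrite mulf_eq0 (negPf q10) (negPf q20).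
have MZ : M `<=` Z by move=> w /MY [].
have [Zs [Zs1 Zs2]] : zdim_ge M k.
  apply: (IH M F') => // i.
  exists (map_poly (slice c) (Q i)).
    apply: contraNneq (Qc i isT) => /(congr1 (fun q : {poly {mpoly K[k]}} => q`_(size (Q i)).-1)).
    by rewrite coef_map coef0 /= -lead_coefE => ->.
  move=> w Mw; rewrite -map_poly_comp -[RHS](QE i w (MZ w Mw)).
  congr (_.[_]); apply: eq_map_poly => q /=.
  by rewrite meval_slice YF //; apply: MY.
exists (fun i => if (i <= k)%N then Zs i else Z); split=> i.
  case: (leqP i k) => [ik _|ki iSk]; first by case: (Zs1 i ik) => h1 h2; split=> // w /h2 /MZ.
  by split.
rewrite ltnS => ik; rewrite ik; case: (ltnP i k) => [ik'|ki]; first exact: Zs2.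
have ei : i = k by apply/eqP; rewrite eqn_leq ik ki.
case: (Zs1 i ik) => h1 h2; split; first by move=> w /h2 /MZ.
(* The last function is constant on [M], so [M = Z] would contradict independence on [Z]. *)
move=> e; have ZM : Z `<=` M by rewrite -e.
have : 'X_ord_max - c%:MP = 0 :> {mpoly K[k.+1]}.
  apply: ind => w Zw; case: (MY _ (ZM _ Zw)) => _ /=.
  by rewrite !mevalB !mevalC mevalXU.
move/(congr1 (meval (fun=> c + 1))); rewrite mevalB mevalC mevalXU meval0 addrC addKr.
by move/eqP; rewrite oner_eq0.
Qed.

End Dominant.

Section UpperBound.
Variables (K : fieldType) (N : nat).

(* A function vanishing on [Z k] but not on [Z k.+1] is independent of those found on [Z k]. *)
Lemma chain_alg_indep k (Z : nat -> set ('I_N -> K)) :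
  (forall i, (i <= k)%N -> zirreducible K N (Z i)) ->
  (forall i, (i < k)%N -> Z i `<=` Z i.+1 /\ Z i <> Z i.+1) ->
  exists F : 'I_k -> {mpoly K[N]}, alg_indep (Z k) (evalf F).
Proof.
elim: k => [|k IH] irr str.
  exists (fun=> 0) => q hq; case: (irr 0%N isT) => _ [w Zw] _.
  by move: (hq w Zw); rewrite (nvar0_mpolyC q) mevalC => ->; rewrite mpolyC0.
have [F indF] := IH (fun i h => irr i (leqW h)) (fun i h => str i (leqW h)).
have [sub neq] := str k (ltnSn k).
have [p pZ npZ] : exists2 p, vanishes p (Z k) & ~ vanishes p (Z k.+1).
  apply: contrapT => h; apply: neq; apply/seteqP; split=> // w Zw.
  apply: zclosedP => [|p pZ]; first by case: (irr k (leqnSn k)).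
  by apply: contrapT => pw; apply: h; exists p => // /(_ w Zw).
exists (ext_ord F p) => G GZ; apply/eqP; rewrite -muni_eq0; apply/eqP.
apply: contrapT => /eqP G0.
(* Write [G] as the [m]-th power of its last variable times [q] with nonzero constant term. No power
   of [p] vanishes on [Z k.+1], so [q(p)] does; on [Z k], where [p] is zero, this kills the constant
   term of [q]. *)
have [m [q + eq]] := multiplicity_XsubC (muni G) 0; rewrite G0 /= => /negP; apply.
have evG w : evalf (ext_ord F p) w = ext_ord (evalf F w) p.@[w].
  by apply/funext => i; rewrite /evalf /ext_ord; case: unlift.
have : vanishes (p ^+ m * (map_poly (comp_fam F) q).[p]) (Z k.+1).
  move=> w Zw; have := GZ w Zw; rewrite evG meval_muni eq subr0.
  rewrite rmorphM rmorphXn /= map_polyX hornerM hornerXn mevalM rmorphXn /=.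
  by rewrite meval_horner_comp mulrC.
have primeX : forall m, ~ vanishes (p ^+ m) (Z k.+1).
  elim=> [|l IHl] h.
    case: (irr k.+1 (leqnn _)) => _ [w /h] + _; rewrite expr0 meval1 => /eqP.
    by rewrite oner_eq0.
  by move: h; rewrite exprS => /(zirreducible_prime (irr k.+1 (leqnn _))) [].
case/(zirreducible_prime (irr k.+1 (leqnn _))) => [/primeX //|h].
apply/rootP; rewrite horner_coef0; apply: indF => w Zw.
have := h w (sub w Zw); rewrite meval_horner_comp pZ // horner_coef0 coef_map => -> //.
Qed.

Lemma not_zdim_ge k (Z : set ('I_N -> K)) :
  (forall F : 'I_k -> {mpoly K[N]}, ~ alg_indep Z (evalf F)) -> ~ zdim_ge Z k.
Proof.
move=> h [Zs [Z1 Z2]].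
have [F indF] := chain_alg_indep (fun i ik => (Z1 i ik).1) Z2.
apply: (h F) => q hq; apply: indF => w Zw; apply: hq.
by case: (Z1 k (leqnn k)) => _; apply.
Qed.

End UpperBound.

(** * The regular locus of a radical tower *)

Section Continuity.
Variable (K : numFieldType).

(** The order of [K] is only partial, but positive elements are real, hence comparable. *)
Lemma exists_lower_bound2 (d1 d2 : K) : 0 < d1 -> 0 < d2 ->
  exists2 d, 0 < d & (d <= d1) && (d <= d2).
Proof.
move=> h1 h2; case: (real_leP (gtr0_real h1) (gtr0_real h2)) => h.
  by exists d1; rewrite // lexx.
by exists d2; rewrite // lexx ltW.
Qed.

Variables (X : Type) (N : K -> X -> Prop).
Hypothesis N_le : forall d d' u, d <= d' -> N d u -> N d' u.
Implicit Types (h : X -> K) (l : K).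

(** [N d u] says that [u] is within [d] of a base point. It is left abstract to cover tuples, row
    vectors and punctured discs alike. *)
Definition eps_lim h l := forall e, 0 < e ->
  exists2 d, 0 < d & forall u, N d u -> `|h u - l| < e.

Lemma eps_lim_cst c : eps_lim (fun=> c) c.
Proof. by move=> e e0; exists 1 => // u _; rewrite subrr normr0. Qed.

Lemma eps_limD h1 h2 l1 l2 : eps_lim h1 l1 -> eps_lim h2 l2 ->
  eps_lim (fun u => h1 u + h2 u) (l1 + l2).
Proof.
move=> c1 c2 e e0; have e20 : 0 < e / 2 by rewrite divr_gt0.
have [d1 d10 H1] := c1 _ e20; have [d2 d20 H2] := c2 _ e20.
have [d d0 /andP[le1 le2]] := exists_lower_bound2 d10 d20.
exists d => // u hu.
have -> : h1 u + h2 u - (l1 + l2) = (h1 u - l1) + (h2 u - l2) by ring.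
rewrite (le_lt_trans (ler_normD _ _)) // [e](splitr e) ltrD //.
  exact/H1/(N_le le1).
exact/H2/(N_le le2).
Qed.

Lemma eps_limM h1 h2 l1 l2 : eps_lim h1 l1 -> eps_lim h2 l2 ->
  eps_lim (fun u => h1 u * h2 u) (l1 * l2).
Proof.
move=> c1 c2 e e0.
pose a := `|l1| + `|l2| + 1.
have a0 : 0 < a by rewrite ltr_wpDl // addr_ge0.
have e2 : 0 < e / (a + a) by rewrite divr_gt0 // addr_gt0.
have [e' e'0 /andP[le1 le2]] := exists_lower_bound2 e2 ltr01.
have [d1 d10 H1] := c1 _ e'0; have [d2 d20 H2] := c2 _ e'0.
have [d d0 /andP[ld1 ld2]] := exists_lower_bound2 d10 d20.
exists d => // u hu.
have H1u := H1 u (N_le ld1 hu); have H2u := H2 u (N_le ld2 hu).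
have -> : h1 u * h2 u - l1 * l2 =
   (h1 u - l1) * (h2 u - l2) + (h1 u - l1) * l2 + l1 * (h2 u - l2) by ring.
have b1 : `|(h1 u - l1) * (h2 u - l2)| <= e' * 1.
  by rewrite normrM ler_pM // ?(ltW H1u) // (le_trans (ltW H2u)).
have b2 : `|(h1 u - l1) * l2| <= e' * `|l2|.
  by rewrite normrM ler_wpM2r // ltW.
have b3 : `|l1 * (h2 u - l2)| <= `|l1| * e'.
  by rewrite normrM ler_wpM2l // ltW.
rewrite (@le_lt_trans _ _ (e' * a)) //.
  apply: le_trans (ler_normD _ _) _; apply: le_trans (lerD (ler_normD _ _) (lexx _)) _.
  apply: le_trans (lerD (lerD b1 b2) b3) _.
  by rewrite /a; have -> : e' * 1 + e' * `|l2| + `|l1| * e' = e' * (`|l1| + `|l2| + 1) by ring.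
rewrite (@lt_le_trans _ _ (e' * (a + a))) //.
  by rewrite ltr_pM2l // ltrDl.
by rewrite -ler_pdivlMr // addr_gt0.
Qed.

Lemma eps_lim_neq0 h l : eps_lim h l -> l != 0 ->
  exists2 d, 0 < d & forall u, N d u -> `|l| / 2 < `|h u|.
Proof.
move=> c h0; have e0 : 0 < `|l| / 2 by rewrite divr_gt0 // normr_gt0.
have [d d0 H] := c _ e0; exists d => // u /H hu.
have := ler_normD (l - h u) (h u); rewrite subrK => le.
have : `|l| < `|l| / 2 + `|h u|.
  by apply: le_lt_trans le _; rewrite ltrD2r distrC.
by rewrite {1}[`|l|]splitr ltrD2l.
Qed.

Lemma eps_limV h l : eps_lim h l -> l != 0 -> eps_lim (fun u => (h u)^-1) l^-1.
Proof.
move=> c h0 e e0; have [d1 d10 H1] := eps_lim_neq0 c h0.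
have a0 : 0 < `|l| by rewrite normr_gt0.
have e'0 : 0 < e * (`|l| / 2 * `|l|) by rewrite mulr_gt0 // mulr_gt0 // divr_gt0.
have [d2 d20 H2] := c _ e'0.
have [d d0 /andP[le1 le2]] := exists_lower_bound2 d10 d20.
exists d => // u hu.
have H1u := H1 u (N_le le1 hu); have H2u := H2 u (N_le le2 hu).
have hu0 : h u != 0.
  by rewrite -normr_gt0; apply: lt_trans H1u; rewrite divr_gt0.
have -> : (h u)^-1 - l^-1 = (l - h u) / (h u * l) by field; rewrite hu0 h0.
rewrite normrM normfV normrM distrC ltr_pdivrMr ?mulr_gt0 ?normr_gt0 //.
apply: lt_trans H2u _; rewrite ltr_pM2l // ltr_pM2r //.
Qed.

Lemma eps_lim_mpoly k (F : 'I_k -> X -> K) (l : 'I_k -> K) (p : {mpoly K[k]}) :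
  (forall i, eps_lim (F i) (l i)) -> eps_lim (fun u => p.@[fun i => F i u]) p.@[l].
Proof.
move=> cF; have ext h h' a : h =1 h' -> eps_lim h a -> eps_lim h' a.
  move=> hh ch e e0; have [d d0 H] := ch e e0; exists d => // u /H.
  by rewrite hh.
elim/mpoly_ring_ind: p => [c|i|p q hp hq|p q hp hq].
- by rewrite mevalC; apply: ext (eps_lim_cst c) => u; rewrite mevalC.
- by rewrite mevalXU; apply: ext (cF i) => u; rewrite mevalXU.
- by rewrite mevalD; apply: ext (eps_limD hp hq) => u; rewrite mevalD.
- by rewrite mevalM; apply: ext (eps_limM hp hq) => u; rewrite mevalM.
Qed.

End Continuity.

Definition near_fun (K : numDomainType) n (v : 'I_n -> K) (d : K) (u : 'I_n -> K) :=
  forall i : 'I_n, `|u i - v i| < d.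

Lemma near_fun_le (K : numDomainType) n (v : 'I_n -> K) (d d' : K) u :
  d <= d' -> near_fun v d u -> near_fun v d' u.
Proof. by move=> dd h i; apply: lt_le_trans dd; apply: h. Qed.

Definition eps_cont (K : numFieldType) n (v : 'I_n -> K) (h : ('I_n -> K) -> K) :=
  eps_lim (near_fun v) h (h v).

Lemma eps_cont_coord (K : numFieldType) n (v : 'I_n -> K) i : eps_cont v (fun u => u i).
Proof. by move=> e e0; exists e => // u; apply. Qed.

Lemma eps_cont_meval (K : numFieldType) n (v : 'I_n -> K) (p : {mpoly K[n]}) :
  eps_cont v (fun u => p.@[u]).
Proof.
apply: (eps_lim_mpoly (@near_fun_le _ _ v) (F := fun i u => u i)) => j.
exact: eps_cont_coord.
Qed.

(** [|x ^+ e - a|] is the product of the distances from [x] to the [e] roots, so the nearest root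
    satisfies the bound. *)
Lemma exists_near_root (K : numClosedFieldType) (e : nat) (x a : K) : (0 < e)%N ->
  exists2 z, z ^+ e = a & `|x - z| ^+ e <= `|x ^+ e - a|.
Proof.
move=> e0; pose p : {poly K} := 'X^e - a%:P.
have sp : size p = e.+1 by rewrite size_XnsubC.
have [rs ers] := closed_field_poly_normal p.
have lp : lead_coef p = 1.
  by rewrite lead_coefDl ?lead_coefXn // size_polyN size_polyXn size_polyC; case: (a != 0).
rewrite lp scale1r in ers.
have srs : size rs = e.
  by apply/eqP; rewrite -eqSS -sp ers size_prod_XsubC.
have root_rs z : z \in rs -> z ^+ e = a.
  move=> zr; have : root p z by rewrite ers root_prod_XsubC.
  by rewrite /root hornerD hornerN hornerXn hornerC subr_eq0 => /eqP.
have px : `|x ^+ e - a| = \prod_(z <- rs) `|x - z|.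
  have -> : x ^+ e - a = p.[x] by rewrite hornerD hornerN hornerXn hornerC.
  rewrite ers horner_prod normr_prod; apply: eq_bigr => z _.
  by rewrite hornerXsubC.
have min s : (0 < size s)%N ->
    exists2 z, z \in s & `|x - z| ^+ size s <= \prod_(z <- s) `|x - z|.
  elim: s => [//|z s IH] _; case: (posnP (size s)) => [/size0nil -> | s0].
    by exists z; rewrite ?mem_head // big_seq1 expr1.
  have [z' z's le'] := IH s0; rewrite big_cons /=.
  case: (real_leP (normr_real (x - z)) (normr_real (x - z'))) => h.
    exists z; first exact: mem_head.
    rewrite exprS ler_wpM2l // (le_trans _ le') //.
    by rewrite lerXn2r // nnegrE.
  exists z'; first by rewrite in_cons z's orbT.
  by rewrite exprS ler_pM // ?exprn_ge0 // ltW.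
have [|z zr le] := min rs; first by rewrite srs.
by exists z; [exact: root_rs | rewrite px -srs].
Qed.

Lemma meval_embed (K : comNzRingType) M N (le : (M <= N)%N) (p : {mpoly K[M]}) w :
  (embed le p).@[w] = p.@[fun i => w (widen_ord le i)].
Proof.
rewrite /embed comp_mpoly_meval; apply: meval_eq => i.
by rewrite tnth_mktuple /mvar mevalXU.
Qed.

Section Radical.
Variables (C : numClosedFieldType) (n m r : nat).
Variables (e : 'I_m -> nat)
          (aN aD : forall i : 'I_m, {mpoly C[n + i]})
          (xN xD : 'I_r -> {mpoly C[n + m]}).
Hypothesis e_gt0 : forall i, (0 < e i)%N.

Definition td_part (w : 'I_(n + m + r) -> C) : 'I_(n + m) -> C := fun a => w (lshift r a).
Definition t_part (w : 'I_(n + m + r) -> C) : 'I_n -> C := fun k => w (lshift r (lshift m k)).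

Definition tvar (k : 'I_n) : {mpoly C[n + m + r]} := 'X_(lshift r (lshift m k)).

Lemma evalf_tvar w : evalf tvar w = t_part w.
Proof. by apply/funext => k; rewrite /evalf mevalXU. Qed.

Definition alpha_at (al : forall i : 'I_m, {mpoly C[n + i]}) (v : 'I_(n + m) -> C) (i : 'I_m) :=
  (embed (le_pref n m i) (al i)).@[v].

Definition tower_pt (l : nat) (v : 'I_(n + m) -> C) := forall i : 'I_m, (i < l)%N ->
  alpha_at aD v i != 0 /\
  v (rshift n i) ^+ e i * alpha_at aD v i = alpha_at aN v i.

(** This is the set [W]; by [projection_equations] its closure is the auxiliary variety. *)
Definition regular_locus : set ('I_(n + m + r) -> C) :=
  [set w | tower_pt m (td_part w) /\ forall j, (xD j).@[td_part w] != 0 /\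
     w (rshift (n + m) j) * (xD j).@[td_part w] = (xN j).@[td_part w]].

Lemma alpha_congr (al : forall i : 'I_m, {mpoly C[n + i]}) (v v' : 'I_(n + m) -> C) (i : 'I_m) :
  (forall a : 'I_(n + m), (a < n + i)%N -> v a = v' a) ->
  (embed (le_pref n m i) (al i)).@[v] = (embed (le_pref n m i) (al i)).@[v'].
Proof. by move=> h; rewrite !meval_embed; apply: meval_eq => a; apply: h => /=. Qed.

Lemma alpha_eps_cont (al : forall i : 'I_m, {mpoly C[n + i]}) (v : 'I_(n + m) -> C) (i : 'I_m) :
  eps_cont v (fun u => (embed (le_pref n m i) (al i)).@[u]).
Proof. exact: eps_cont_meval. Qed.

(* Once [t] has been moved off [a = 0], the branches are followed one level at a time, since
   the roots of [z ^ e = alpha] depend continuously on [alpha]. *)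
Lemma tower_dense l (a : {mpoly C[n]}) v ep : (l <= m)%N -> a != 0 -> tower_pt l v ->
  0 < ep -> exists v', [/\ tower_pt l v', near_fun v ep v' &
    a.@[fun k => v' (lshift m k)] != 0].
Proof.
move=> + a0; elim: l v ep => [|l IH] v ep lm vl ep0.
  have [u uv au] := mpoly_neq0_near (fun k => v (lshift m k)) a0 ep0.
  exists (fun k => match fintype.split k with inl k => u k | inr i => v (rshift n i) end).
  split=> // [k|].
    by rewrite -[k]splitK; case: (fintype.split k) => j; rewrite unsplitK /= ?subrr ?normr0.
  rewrite (meval_eq _ (v2 := u)) // => k.
  by rewrite (unsplitK (inl k)).
pose i := Ordinal lm.
have [Di Ei] := vl i (ltnSn l).
have vl' : tower_pt l v by move=> j jl; apply: vl; exact: ltnW.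
pose x := v (rshift n i).
have cD := alpha_eps_cont aD v i; have cN := alpha_eps_cont aN v i.
have [d1 d10 H1] := eps_lim_neq0 cD Di.
(* Nearby denominators exceed half of the one at [v], so an error below [ep'] in the cleared
   equation gives an error below [ep ^+ e i] for the quotient, hence a root within [ep]. *)
pose ep' := ep ^+ e i * (`|alpha_at aD v i| / 2).
have ep'0 : 0 < ep' by rewrite mulr_gt0 ?exprn_gt0 // divr_gt0 // normr_gt0.
have nle := @near_fun_le C _ v.
have cE := eps_limD nle (eps_limM nle (eps_lim_cst _ (x ^+ e i)) cD)
             (eps_limM nle (eps_lim_cst _ (-1)) cN).
have [d2 d20 H2] := cE _ ep'0.
have [d3 d30 /andP[l31 l32]] := exists_lower_bound2 d10 d20.
have [d d0 /andP[l3 le]] := exists_lower_bound2 d30 ep0.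
have [v' [v'l v'n av']] := IH v d (ltnW lm) vl' d0.
have H1v := H1 v' (near_fun_le (le_trans l3 l31) v'n).
have H2v := H2 v' (near_fun_le (le_trans l3 l32) v'n).
have D'0 : alpha_at aD v' i != 0.
  by rewrite -normr_gt0; apply: lt_trans H1v; rewrite divr_gt0 // normr_gt0.
have [z ez lz] := exists_near_root x (alpha_at aN v' i / alpha_at aD v' i) (e_gt0 i).
have xz : `|x - z| < ep.
  rewrite -(ltr_pXn2r (e_gt0 i)) ?nnegrE ?(ltW ep0) //.
  apply: le_lt_trans lz _.
  have -> : x ^+ e i - alpha_at aN v' i / alpha_at aD v' i =
     (x ^+ e i * alpha_at aD v' i + -1 * alpha_at aN v' i) / alpha_at aD v' i.
    by rewrite mulN1r mulrBl mulfK.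
  rewrite normrM normfV ltr_pdivrMr ?normr_gt0 //.
  have : `|x ^+ e i * alpha_at aD v' i + -1 * alpha_at aN v' i -
      (x ^+ e i * alpha_at aD v i + -1 * alpha_at aN v i)| < ep' := H2v.
  rewrite Ei [X in _ - (_ + X)]mulN1r subrr subr0 => /lt_trans; apply.
  by rewrite ltr_pM2l ?exprn_gt0.
pose v'' k := if k == rshift n i then z else v' k.
(* Replacing the coordinate of level [i] leaves the radicands of levels up to [i] unchanged. *)
have v''E (j : 'I_m) (a' : 'I_(n + m)) : (j <= i)%N -> (a' < n + j)%N -> v'' a' = v' a'.
  move=> ji a'j; rewrite /v''; case: eqP => // ea; move: a'j; rewrite ea /=.
  by rewrite ltn_add2l ltnNge ji.
exists v''; split=> [j|k|].
- rewrite ltnS => jl.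
  have aE (al : forall i : 'I_m, {mpoly C[n + i]}) :
      (embed (le_pref n m j) (al j)).@[v''] = (embed (le_pref n m j) (al j)).@[v'].
    by apply: alpha_congr => a' /(v''E j a' jl).
  have eD : alpha_at aD v'' j = alpha_at aD v' j by apply: aE.
  have eN : alpha_at aN v'' j = alpha_at aN v' j by apply: aE.
  rewrite eD eN.
  rewrite /v'' eq_rshift; case: (eqVneq j i) => [->|ji].
    by split; rewrite // ez divfK.
  apply: v'l; rewrite ltn_neqAle jl andbT.
  by apply: contra ji => /eqP h; apply/eqP/val_inj.
- rewrite /v''; case: eqP => [->|_]; first by rewrite distrC.
  exact: lt_le_trans (v'n k) le.
- rewrite (meval_eq _ (v2 := fun k => v' (lshift m k))) // => k.
  by rewrite /v'' eq_lrshift.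
Qed.

(** On the locus, [X] is a continuous function of [(T, Delta)]. A polynomial nonzero at a point
    stays nonzero nearby, and [tower_dense] provides nearby points with [a(T)] nonzero. *)
Lemma regular_locus_dense (a : {mpoly C[n]}) (p : {mpoly C[n + m + r]}) : a != 0 ->
  vanishes p (regular_locus `&` [set w | (comp_fam tvar a).@[w] != 0]) ->
  vanishes p regular_locus.
Proof.
move=> a0 pv w [wt wx]; apply/eqP; apply: contraT => pw.
pose ex (v : 'I_(n + m) -> C) (k : 'I_(n + m + r)) : C :=
  match fintype.split k with inl b => v b | inr j => (xN j).@[v] / (xD j).@[v] end.
have exl v b : ex v (lshift r b) = v b by rewrite /ex (unsplitK (inl b)).
have exr v j : ex v (rshift (n + m) j) = (xN j).@[v] / (xD j).@[v].
  by rewrite /ex (unsplitK (inr j)).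
have wE : w = ex (td_part w).
  apply/funext => k; rewrite -(splitK k); case: (fintype.split k) => [b|j] /=.
    by rewrite exl.
  by rewrite exr; case: (wx j) => h1 h2; rewrite -h2 mulfK.
set v := td_part w.
have nle := @near_fun_le C _ v.
have cp : eps_cont v (fun u => p.@[ex u]).
  apply: (eps_lim_mpoly nle (F := fun i u => ex u i)) => k; rewrite /ex.
  case: (fintype.split k) => [b|j]; first exact: eps_cont_coord.
  apply: eps_limM => //; first exact: eps_cont_meval.
  by apply: eps_limV => //; [exact: eps_cont_meval | case: (wx j)].
have [|d1 d10 H1] := eps_lim_neq0 cp; first by rewrite -wE.
have [d d0 dx] : exists2 d, 0 < d & forall u, near_fun v d u -> forall j, (xD j).@[u] != 0.
  have : forall j, exists2 d, 0 < d & forall u, near_fun v d u -> (xD j).@[u] != 0.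
    move=> j; have [|d d0 H] := eps_lim_neq0 (eps_cont_meval v (xD j)); first by case: (wx j).
    exists d => // u /H h; rewrite -normr_gt0; apply: lt_trans h.
    by rewrite divr_gt0 // normr_gt0; case: (wx j).
  elim: (r) (xD) => [|l IH] xD' hx; first by exists 1 => // u _ [].
  have [d2 d20 H2] := IH _ (fun j => hx (lift ord0 j)).
  have [d3 d30 H3] := hx ord0.
  have [d d0 /andP[l1 l2]] := exists_lower_bound2 d20 d30.
  exists d => // u hu j; case: (unliftP ord0 j) => [j'|] ->.
    exact/H2/(near_fun_le l1).
  exact/H3/(near_fun_le l2).
have [d2 d20 /andP[l1 l2]] := exists_lower_bound2 d10 d0.
have [v' [v't v'n av']] := tower_dense (leqnn m) a0 wt d20.
have td' : td_part (ex v') = v' by apply/funext => b; rewrite /td_part exl.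
have := H1 v' (near_fun_le l1 v'n); rewrite (pv (ex v')).
  by rewrite normr0 le_gtF // divr_ge0.
split; last first.
  suff e1 : (comp_fam tvar a).@[ex v'] = a.@[fun k => v' (lshift m k)].
    by rewrite /= e1.
  by rewrite comp_famE; apply: meval_eq => k; rewrite mevalXU exl.
split; first by rewrite td'.
move=> j; rewrite td'; have h := dx v' (near_fun_le l2 v'n) j.
by rewrite exr divfK.
Qed.

End Radical.

(** * Dimension of subvarieties of the regular locus *)

Lemma exists_partial_eval (K : comNzRingType) N (w : 'I_N -> K) (p : {mpoly K[N + 1]}) :
  exists q : {poly K}, forall z,
    q.[z] = p.@[fun k => match fintype.split k with inl a => w a | inr _ => z end].
Proof.
elim/mpoly_ring_ind: p => [c|i|p1 p2 [q1 e1] [q2 e2]|p1 p2 [q1 e1] [q2 e2]].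
- by exists c%:P => z; rewrite mevalC hornerC.
- case E: (fintype.split i) => [a|a].
    by exists (w a)%:P => z; rewrite mevalXU E hornerC.
  by exists 'X => z; rewrite mevalXU E hornerX.
- by exists (q1 + q2) => z; rewrite hornerD mevalD e1 e2.
- by exists (q1 * q2) => z; rewrite hornerM mevalM e1 e2.
Qed.

Lemma meval_binomial (K : comNzRingType) N (k : 'I_N) c (p q : {mpoly K[N]}) w :
  (mvar K k ^+ c * p - q).@[w] = w k ^+ c * p.@[w] - q.@[w].
Proof. by rewrite mevalB mevalM rmorphXn /= mevalXU. Qed.

Section CoordinateProjection.
Variables (K : fieldType) (N N' : nat) (s : 'I_N' -> 'I_N).
Local Notation pr := (fun (w : 'I_N -> K) j => w (s j)).

Definition pull (p : {mpoly K[N']}) : {mpoly K[N]} := comp_fam (fun j => 'X_(s j)) p.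

Lemma meval_pull p w : (pull p).@[w] = p.@[pr w].
Proof. by rewrite comp_famE; apply: meval_eq => j; rewrite mevalXU. Qed.

Lemma vanishes_projection p Z : vanishes p (zclosure (pr @` Z)) <-> vanishes (pull p) Z.
Proof.
split=> [h w Zw|h].
  by rewrite meval_pull; apply: h; apply: subset_zclosure; exists w.
by apply: zclosure_vanishes => _ [w Zw <-]; rewrite -meval_pull; apply: h.
Qed.

Lemma zirreducible_projection Z : zirreducible _ _ Z ->
  zirreducible _ _ (zclosure (pr @` Z)).
Proof.
move=> irr; apply: zirreducible_closure.
  by case: irr => _ [w Zw] _; exists (pr w), w.
move=> p q pq.
have pqZ : vanishes (pull p * pull q) Z.
  by move=> w Zw; rewrite mevalM !meval_pull -mevalM; apply: pq; exists w.
case: (zirreducible_prime irr pqZ) => h; [left|right] => _ [w Zw <-];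
  by rewrite -meval_pull h.
Qed.

End CoordinateProjection.

Section Radical.
Variables (C : numClosedFieldType) (n m r : nat).
Variables (e : 'I_m -> nat)
          (aN aD : forall i : 'I_m, {mpoly C[n + i]})
          (xN xD : 'I_r -> {mpoly C[n + m]}).
Hypothesis e_gt0 : forall i, (0 < e i)%N.

Local Notation locus := (regular_locus e aN aD xN xD).
Local Notation f := (evalf (@tvar C n m r)).

(** The tower is climbed with [fin_adjoin], the radicand of each level being available thanks to
    [fin_inv]; the coordinates [X] are then quotients. *)
Lemma locus_fin : exists (J : finType) (g : J -> ('I_(n + m + r) -> C) -> C) (j0 : J),
  (forall w, locus w -> g j0 w = 1) /\ forall k, fin locus f g (fun w => w k).
Proof.
have coord_t (J : finType) (g : J -> ('I_(n + m + r) -> C) -> C) (k : 'I_n) :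
    fin locus f g (fun w => w (lshift r (lshift m k))).
  by apply: fin_ext (fin_meval _ _ g 'X_k) _ => w _; rewrite mevalXU /evalf mevalXU.
have sub_td (J : finType) (g : J -> ('I_(n + m + r) -> C) -> C) (l : nat) :
    (forall i : 'I_m, (i < l)%N -> fin locus f g (fun w => w (lshift r (rshift n i)))) ->
    forall b : 'I_(n + m), (b < n + l)%N -> fin locus f g (fun w => w (lshift r b)).
  move=> h b; case: (split_ordP b) => [k|i] -> lt; first exact: coord_t.
  by apply: h; rewrite -(ltn_add2l n).
have tower l : (l <= m)%N ->
    exists (J : finType) (g : J -> ('I_(n + m + r) -> C) -> C) (j0 : J),
    (forall w, locus w -> g j0 w = 1) /\
    forall i : 'I_m, (i < l)%N -> fin locus f g (fun w => w (lshift r (rshift n i))).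
  elim: l => [|l IH] lm; first by exists unit, (fun _ _ => 1), tt.
  have [J [g [j0 [g0 hg]]]] := IH (ltnW lm).
  pose i := Ordinal lm.
  have alpha_fin (al : forall i : 'I_m, {mpoly C[n + i]}) :
      fin locus f g (fun w => (embed (le_pref n m i) (al i)).@[td_part w]).
    have := @fin_mpoly _ _ _ locus f J g (n + i)
      (fun a w => td_part w (widen_ord (le_pref n m i) a)) (al i).
    move=> h; apply: fin_ext (h _) _ => [a|w _]; last by rewrite meval_embed.
    by apply: (sub_td _ _ l) => //=; apply: ltn_ord.
  have g0' w : locus w -> g j0 w != 0 by move=> /g0 ->; apply: oner_neq0.
  have D0 w : locus w -> (embed (le_pref n m i) (aD i)).@[td_part w] != 0.
    by move=> [/(_ i (ltn_ord i)) []].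
  have alf := finM (alpha_fin aN) (fin_inv g0' (alpha_fin aD) D0).
  set al := (fun w => _ * _) in alf.
  (* The relation is monic and pure: only the constant coefficient, the radicand, is nonzero. *)
  have [|l'|w Lw|J' [g' [j1 [g1 h1 h2]]]] := @fin_adjoin _ _ _ locus f J g j0
      (fun w => w (lshift r (rshift n i))) (e i)
      (fun l' w => if l' == 0 :> nat then al w else 0) 1 g0 (e_gt0 i).
  - exact: oner_neq0.
  - case: eqP => _ //; apply: fin_ext (fin_meval _ _ _ 0) _ => w _.
    by rewrite meval0.
  - rewrite meval1 mul1r (bigD1 (Ordinal (e_gt0 i))) //= expr0 mulr1 big1 ?addr0.
      by case: Lw => /(_ i (ltn_ord i)) [d0 ed] _; rewrite /al -[X in X / _]ed mulfK.
    move=> l' l'0; case: eqP => [h|_]; last by rewrite mul0r.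
    by case/eqP: l'0; apply/val_inj.
  exists J', g', j1; split=> // i'; rewrite ltnS leq_eqVlt => /orP[/eqP ei|i'l].
    by have -> : i' = i by apply/val_inj.
  exact/h2/hg.
have [J [g [j0 [g0 hg]]]] := tower m (leqnn m).
have td b : fin locus f g (fun w => w (lshift r b)) by apply: (sub_td _ _ m).
have g0' w : locus w -> g j0 w != 0 by move=> /g0 ->; apply: oner_neq0.
exists J, g, j0; split=> // k; case: (split_ordP k) => [b|j] ->; first exact: td.
have hN := fin_mpoly (xN j) td; have hD := fin_mpoly (xD j) td.
have D0 w : locus w -> (xD j).@[td_part w] != 0 by move=> [_ /(_ j) []].
apply: fin_ext (finM hN (fin_inv g0' hD D0)) _ => w [_ /(_ j) [d0 ed]].
by rewrite -[X in _ = X / _]ed mulfK.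
Qed.

Lemma meval_algebraic_over_locus p : algebraic_over locus f (fun w => p.@[w]).
Proof.
have [J [g [j0 [g0 hg]]]] := locus_fin.
apply: (fin_algebraic (j0 := j0)) (fin_mpoly p hg).
by move=> w /g0 ->; apply: oner_neq0.
Qed.

Lemma algebraic_over_locus k : algebraic_over (zclosure locus) f (fun w => w k).
Proof.
have [Q Q0 QE] := meval_algebraic_over_locus 'X_k.
exists Q => // w Lw.
have h : vanishes (map_poly (comp_fam (@tvar C n m r)) Q).['X_k] locus.
  by move=> v Lv; rewrite meval_horner_comp QE.
by have := zclosure_vanishes h Lw; rewrite meval_horner_comp mevalXU.
Qed.

(** Counting gives [b(T) * G(F) = 0] on the locus, hence on [Z]. Irreducibility and independence of
    [T] then remove the factor [b(T)]. *)
Lemma locus_dependent Z (F : 'I_n.+1 -> {mpoly C[n + m + r]}) :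
  zirreducible _ _ Z -> Z `<=` zclosure locus -> alg_indep Z f ->
  exists2 G, G != 0 & forall w, Z w -> G.@[evalf F w] = 0.
Proof.
move=> irr sub ind; have [J [g [j0 [g0 hg]]]] := locus_fin.
have [|G [b [G0 b0 Gb]]] := @fin_dependent _ _ _ locus f J g j0 (fun i w => (F i).@[w]) g0.
  by move=> i; apply: fin_mpoly.
exists G => // w Zw.
have h : vanishes (comp_fam (@tvar C n m r) b * comp_fam F G) locus.
  by move=> v Lv; rewrite mevalM !comp_famE; apply: Gb.
have h' : vanishes (comp_fam (@tvar C n m r) b * comp_fam F G) Z.
  by move=> v /sub; apply: zclosure_vanishes.
case: (zirreducible_prime irr h') => [bZ|/(_ w Zw)]; last by rewrite comp_famE.
case/eqP: b0; apply: ind => v Zv; have := bZ v Zv; by rewrite comp_famE.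
Qed.

Lemma zdim_sub_locus Z : zirreducible _ _ Z -> Z `<=` zclosure locus ->
  alg_indep Z f -> zdim _ _ Z n.
Proof.
move=> irr sub ind; split.
  apply: zdim_ge_alg_indep irr ind _ => k.
  have [Q Q0 QE] := algebraic_over_locus k; exists Q => // w Zw.
  exact: (QE w (sub w Zw)).
apply: not_zdim_ge => F indF; have [G + GE] := locus_dependent F irr sub ind.
by rewrite (indF G GE) eqxx.
Qed.

Lemma zcomponent_locus_alg_indep Z : zcomponent _ _ (zclosure locus) Z -> alg_indep Z f.
Proof.
move=> cZ q qZ; apply/eqP; apply: contraT => q0.
have := @zcomponent_generic _ _ _ _ (comp_fam (@tvar C n m r) q) cZ.
case=> [p|w Zw]; first exact: regular_locus_dense.
by rewrite comp_famE; apply: qZ.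
Qed.

Definition coord_x (w : 'I_(n + m + r) -> C) : 'I_r -> C := fun j => w (rshift (n + m) j).

(** Any [n + 1] polynomials on the image are dependent, since their pullbacks to [Z] are. This
    yields the upper bound and also the algebraicity of the coordinates over [F], needed for the
    lower bound. *)
Lemma zdim_projection Z (F : 'I_n -> {mpoly C[r]}) :
  zirreducible _ _ Z -> Z `<=` zclosure locus -> alg_indep Z f ->
  alg_indep (coord_x @` Z) (evalf F) ->
  zirreducible _ _ (zclosure (coord_x @` Z)) /\
  zdim _ _ (zclosure (coord_x @` Z)) n.
Proof.
move=> irr sub ind indF; set V := zclosure _.
have irrV : zirreducible _ _ V by apply: zirreducible_projection.
have dep (E : 'I_n.+1 -> {mpoly C[r]}) :
    exists2 G, G != 0 & forall w, V w -> G.@[evalf E w] = 0.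
  pose s (j : 'I_r) := rshift (n + m) j.
  have [G G0 GE] := locus_dependent (fun i => pull s (E i)) irr sub ind.
  exists G => // w Vw.
  have : vanishes (comp_fam E G) V.
    apply/vanishes_projection => v Zv; rewrite meval_pull comp_famE -[RHS](GE v Zv).
    by apply: meval_eq => i; rewrite /evalf meval_pull.
  by move=> /(_ w Vw); rewrite comp_famE.
have indV : alg_indep V (evalf F).
  by move=> q qV; apply: indF => w Zw; apply: qV; apply: subset_zclosure.
split=> //; split.
  apply: zdim_ge_alg_indep irrV indV _ => k.
  have [G G0 GE] := dep (ext_ord F 'X_k).
  exists (muni G); first by rewrite muni_eq0.
  move=> w Vw; rewrite -meval_muni -[RHS](GE w Vw); apply: meval_eq => i.
  by rewrite /evalf /ext_ord; case: unlift => //; rewrite mevalXU.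
apply: not_zdim_ge => E indE; have [G + GE] := dep E.
by rewrite (indE G GE) eqxx.
Qed.

(** These four definitions restate [polE], [polG], [polGZ] and [denominators] over any algebraically
    closed numeric field. *)
Definition eqE (i : 'I_m) : {mpoly C[n + m + r + 1]} :=
  mvar C (idxDelta n m r i) ^+ e i * embed (le_Di_all n m r i) (aD i)
  - embed (le_Di_all n m r i) (aN i).
Definition eqG (j : 'I_r) : {mpoly C[n + m + r + 1]} :=
  mvar C (idxX n m r j) * embed (le_TD_all n m r) (xD j)
  - embed (le_TD_all n m r) (xN j).
Definition eqZ (L : {mpoly C[n + m + r + 1]}) : {mpoly C[n + m + r + 1]} :=
  mvar C (idxZ n m r) * L - 1.
Definition dens : seq {mpoly C[n + m + r + 1]} :=
  [seq embed (le_TD_all n m r) (xD j) | j <- enum 'I_r] ++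
  [seq embed (le_Di_all n m r i) (aD i) | i <- enum 'I_m].

(** The last equation forces [L], hence every denominator, to be nonzero. Conversely, [L] might a
    priori involve [Z]; over a point of the locus it divides a product without zeros, so as a
    polynomial in [Z] it is a nonzero constant, whose inverse is the required value of [Z]. *)
Lemma projection_equations (L : {mpoly C[n + m + r + 1]}) :
  is_lcm C (n + m + r + 1) dens L ->
  (fun w : 'I_(n + m + r + 1) -> C => fun k => w (lshift 1 k)) @`
    zero_set [set p | (exists i, p = eqE i) \/ (exists j, p = eqG j) \/ p = eqZ L] = locus.
Proof.
move=> [Ldiv Lmin].
pose wl (w : 'I_(n + m + r + 1) -> C) : 'I_(n + m + r) -> C := fun k => w (lshift 1 k).
have evTD (p : {mpoly C[n + m]}) w : (embed (le_TD_all n m r) p).@[w] = p.@[td_part (wl w)].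
  by rewrite meval_embed; apply: meval_eq => a; congr w; apply/val_inj.
have evDi (i : 'I_m) (p : {mpoly C[n + i]}) w :
    (embed (le_Di_all n m r i) p).@[w] = (embed (le_pref n m i) p).@[td_part (wl w)].
  by rewrite !meval_embed; apply: meval_eq => a; congr w; apply/val_inj.
have evE i w : (eqE i).@[w] =
    td_part (wl w) (rshift n i) ^+ e i * alpha_at aD (td_part (wl w)) i
      - alpha_at aN (td_part (wl w)) i.
  by rewrite meval_binomial !evDi.
have evG j w : (eqG j).@[w] =
    wl w (rshift (n + m) j) * (xD j).@[td_part (wl w)] - (xN j).@[td_part (wl w)].
  by rewrite [LHS](meval_binomial _ 1) !evTD expr1.
have evZ w : (eqZ L).@[w] = w (idxZ n m r) * L.@[w] - 1.
  by rewrite [LHS](meval_binomial _ 1) meval1 expr1.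
have denX j : embed (le_TD_all n m r) (xD j) \in dens.
  rewrite mem_cat; apply/orP; left.
  by apply: (map_f (fun j => embed (le_TD_all n m r) (xD j))); rewrite mem_enum.
have denA i : embed (le_Di_all n m r i) (aD i) \in dens.
  rewrite mem_cat; apply/orP; right.
  by apply: (map_f (fun i => embed (le_Di_all n m r i) (aD i))); rewrite mem_enum.
apply/seteqP; split=> [_ [w hw <-]|w [wt wx]].
  have L0 : L.@[w] != 0.
    apply/eqP => L0; have /eqP := hw (eqZ L) (or_intror (or_intror erefl)).
    by rewrite evZ L0 mulr0 sub0r oppr_eq0 oner_eq0.
  have d0 p : p \in dens -> p.@[w] != 0.
    move=> /Ldiv [s Ls]; apply: contraNneq L0 => p0.
    by rewrite Ls mevalM p0 mul0r.
  split=> [i _|j].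
    split; first by rewrite /alpha_at -evDi; apply/d0/denA.
    apply/eqP; rewrite -subr_eq0 -evE; apply/eqP/hw.
    by left; exists i.
  split; first by rewrite -evTD; apply/d0/denX.
  apply/eqP; rewrite -subr_eq0 -evG; apply/eqP/hw.
  by right; left; exists j.
pose ex z : 'I_(n + m + r + 1) -> C :=
  fun k => match fintype.split k with inl a => w a | inr _ => z end.
have wlex z : wl (ex z) = w.
  by apply/funext => k; rewrite /wl /ex (unsplitK (inl k)).
pose P := \prod_(p <- dens) p.
have [s Ps] : mdvd L P.
  apply: Lmin => p pd; rewrite /P (big_rem p pd) /=.
  by exists (\prod_(y <- rem p (dens)) y).
have P0 z : P.@[ex z] != 0.
  rewrite /P rmorph_prod /= prodf_seq_neq0; apply/allP => p.
  rewrite mem_cat => /orP[/mapP [j _ ->]|/mapP [i _ ->]] /=.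
    by rewrite evTD wlex; case: (wx j).
  by rewrite evDi wlex; case: (wt i (ltn_ord i)).
have [q qE] := exists_partial_eval w L.
have sq : size q == 1%N.
  apply/negP => /negP /closed_rootP [z /rootP qz].
  have := P0 z; rewrite Ps mevalM; rewrite qE in qz.
  by rewrite [L.@[_]]qz mul0r eqxx.
have [c c0 qc] := size_poly1P _ sq.
have LE z : L.@[ex z] = c by rewrite -[c](hornerC c z) -qc qE.
exists (ex c^-1); last exact: wlex.
move=> _ [[i ->]|[[j ->]|->]].
- by rewrite evE wlex; case: (wt i (ltn_ord i)) => _ ->; rewrite subrr.
- by rewrite evG wlex; case: (wx j) => _ ->; rewrite subrr.
- by rewrite evZ LE /ex (unsplitK (inr _)) mulVf // subrr.
Qed.

End Radical.

End AlgebraicPart.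

From mathcomp Require Import all_classical all_reals all_analysis.
From mathcomp Require Import complex.
From mathcomp Require Import lra.
Import (canonicals) mpoly.
Import Order.TTheory GRing.Theory Num.Theory.
Import numFieldNormedType.Exports.
Local Open Scope ring_scope.
Local Open Scope classical_set_scope.

Module AnalyticPart.

Set Implicit Arguments.
Unset Strict Implicit.
Unset Printing Implicit Defensive.
Import AlgebraicPart.
Local Notation "p .@[ v ]" := (mpoly.meval v p)
  (at level 1, left associativity, format "p .@[ v ]").

(** * An identity principle for algebraic functions *)

Lemma connected_sub (T : topologicalType) (A P : set T) : connected A ->
  (exists2 x, A x & P x) ->
  (forall x, A x -> P x -> \forall y \near x, A y -> P y) ->
  (forall x, A x -> ~ P x -> \forall y \near x, A y -> ~ P y) -> A `<=` P.
Proof.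
move=> cA [x0 Ax0 Px0] hP hN.
suff : A `&` P = A by move=> e x; rewrite -e => -[].
apply: cA; first by exists x0.
- exists (interior [set y | A y -> P y]); first exact: open_interior.
  apply/seteqP; split=> x [Ax h]; split=> //; first exact: hP.
  exact: (nbhs_singleton h).
- exists (~` interior [set y | A y -> ~ P y]).
    exact/open_closedC/open_interior.
  apply/seteqP; split=> x [Ax h]; split=> //.
    by move=> /nbhs_singleton /(_ Ax).
  by apply: contrapT => nP; apply: h; apply: hN.
Qed.

Section Identity.
Variables (K : numFieldType) (n : nat).
Implicit Types (t u : 'rV[K^o]_n).

Definition crd t : 'I_n -> K := fun k => t ord0 k.
Definition near_row t (d : K) u := near_fun (crd t) d (crd u).

Lemma near_row_le t d d' u : d <= d' -> near_row t d u -> near_row t d' u.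
Proof. exact: near_fun_le. Qed.

Lemma nbhs_near_row t (A : set 'rV[K^o]_n) :
  nbhs t A <-> exists2 d, 0 < d & forall u, near_row t d u -> A u.
Proof.
split=> [/nbhs_ballP [d d0 tA]|[d d0 tA]].
  exists d => // u tu; apply: tA; split=> // i j.
  by rewrite ord1 /ball /= distrC; apply: tu.
apply/nbhs_ballP; exists d => // u tu; apply: tA => k.
by have := tu.2 ord0 k; rewrite /ball /= distrC.
Qed.

Lemma nbhs_mpoly_neq0 (p : mpoly.mpoly n K) t (A : set 'rV[K^o]_n) :
  p != 0 -> nbhs t A -> exists2 u, A u & p.@[crd u] != 0.
Proof.
move=> p0 /nbhs_near_row [e e0 tA].
have [u ut pu] := mpoly_neq0_near (crd t) p0 e0.
have cu : crd (\row_k u k) = u by apply/funext => k; rewrite /crd mxE.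
by exists (\row_k u k); [apply: tA; rewrite /near_row cu | rewrite cu].
Qed.

Definition cont_row t (h : 'rV[K^o]_n -> K) := eps_lim (near_row t) h (h t).

Lemma cont_row_meval t p : cont_row t (fun u => p.@[crd u]).
Proof.
apply: (eps_lim_mpoly (@near_row_le t) (F := fun k u => crd u k)) => k.
by move=> e e0; exists e => // u; apply.
Qed.

Lemma cont_row_horner t h (Q : {poly mpoly.mpoly n K}) : cont_row t h ->
  cont_row t (fun u => (map_poly (mpoly.meval (crd u)) Q).[h u]).
Proof.
move=> ch; elim/poly_ind: Q => [|Q c IH].
  move=> e e0; exists 1 => // u _.
  by rewrite !rmorph0 !horner0 subrr normr0.
have E u : (map_poly (mpoly.meval (crd u)) (Q * 'X + c%:P)).[h u] =
    (map_poly (mpoly.meval (crd u)) Q).[h u] * h u + c.@[crd u].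
  by rewrite rmorphD rmorphM /= map_polyX map_polyC /= !hornerE.
rewrite /cont_row E => e e0.
have nle := @near_row_le t.
have [d d0 H] := eps_limD nle (eps_limM nle IH ch) (cont_row_meval t c) e0.
by exists d => // u /H; rewrite E.
Qed.

(* The segment from 0 to 1 can be deformed so as to avoid the roots of a polynomial. *)
Definition has_avoiding_paths := forall q : {poly K}, q.[0] != 0 -> q.[1] != 0 ->
  exists (T : topologicalType) (I : set T) (z : T -> K) (x0 x1 : T),
    [/\ connected I, I x0 /\ I x1, z x0 = 0 /\ z x1 = 1,
        forall x, I x -> `|z x| <= 2 /\ q.[z x] != 0 &
        forall x, I x -> forall d, 0 < d -> \forall y \near x, `|z y - z x| < d].

Hypothesis paths : has_avoiding_paths.
Variable (U : set 'rV[K^o]_n).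
Hypothesis (openU : open U) (connU : connected U).

Section Relation.
Variables (h : 'rV[K^o]_n -> K) (Q : {poly mpoly.mpoly n K}) (m : nat).
Hypothesis h_cont : forall t, U t -> cont_row t h.
Hypothesis Q0 : Q`_0 != 0.
Hypothesis h_rel : forall t, U t ->
  h t ^+ m * (map_poly (mpoly.meval (crd t)) Q).[h t] = 0.
Local Notation c := (Q`_0).

(** Near [t] the value of [Q] at [h] stays close to the nonzero [c(t)], so the power of [h] must be
    the factor that vanishes. *)
Lemma zero_locally t : U t -> h t = 0 -> c.@[crd t] != 0 ->
  exists2 d, 0 < d & forall u, U u -> near_row t d u -> h u = 0.
Proof.
move=> Ut ht ct.
have [|d d0 H] := eps_lim_neq0 (cont_row_horner Q (h_cont Ut)).
  by rewrite ht horner_coef0 coef_map.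
exists d => // u Uu /H lt; have /eqP := h_rel Uu.
rewrite mulf_eq0 expf_eq0 => /orP[/andP[_ /eqP //]|/eqP e0].
by move: lt; rewrite e0 normr0 le_gtF // divr_ge0.
Qed.

Lemma nonzero_locally t : U t -> h t != 0 ->
  exists2 d, 0 < d & forall u, near_row t d u -> h u != 0.
Proof.
move=> Ut ht; have [d d0 H] := eps_lim_neq0 (h_cont Ut) ht; exists d => // u /H.
by apply: contraTneq => ->; rewrite normr0 le_gtF // divr_ge0.
Qed.

(** On the complex line through [a] and [s], an avoiding path stays off [c = 0]; along it the zero
    set of [h] is open and closed. *)
Lemma zero_along_path t d a s : 0 < d -> (forall u, near_row t d u -> U u) ->
  near_row t (d / 6) a -> near_row t (d / 6) s ->
  c.@[crd a] != 0 -> c.@[crd s] != 0 -> h a = 0 -> h s = 0.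
Proof.
move=> d0 dU ta ts ca cs ha.
pose g (z : K) : 'rV[K^o]_n := \row_k (crd a k + z * (crd s k - crd a k)).
have cg z : crd (g z) = fun k => crd a k + z * (crd s k - crd a k).
  by apply/funext => k; rewrite /crd mxE.
have g0 : g 0 = a by apply/rowP => k; rewrite mxE mul0r addr0.
have g1 : g 1 = s by apply/rowP => k; rewrite mxE mul1r addrC subrK.
have [q qE] : exists q : {poly K}, forall z, q.[z] = c.@[crd (g z)].
  elim/mpoly_ring_ind: (c) => [b|i|p1 p2 [q1 e1] [q2 e2]|p1 p2 [q1 e1] [q2 e2]].
  - by exists b%:P => z; rewrite mpoly.mevalC hornerC.
  - exists ((crd a i)%:P + 'X * (crd s i - crd a i)%:P) => z.
    by rewrite mpoly.mevalXU cg !hornerE.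
  - by exists (q1 + q2) => z; rewrite hornerD mpoly.mevalD e1 e2.
  - by exists (q1 * q2) => z; rewrite hornerM mpoly.mevalM e1 e2.
have [||T [I [z [x0 [x1 [cI [I0 I1] [z0 z1] zI zc]]]]]] := paths (q := q).
- by rewrite qE g0.
- by rewrite qE g1.
have d60 : 0 < d / 6 by rewrite divr_gt0.
have sa k : `|crd s k - crd a k| <= d / 6 + d / 6.
  rewrite -[crd s k](subrK (crd t k)) -addrA (le_trans (ler_normD _ _)) // lerD ?ltW //.
  by rewrite distrC; apply: ta.
have sad k : `|crd s k - crd a k| <= d.
  apply: le_trans (sa k) _.
  have -> : d / 6 + d / 6 = d * (2 / 6) by field.
  by rewrite ler_piMr ?(ltW d0) // ler_pdivrMr // mul1r ler_nat.
(* Why 6: the parameter is bounded by 2 and [s - a] by [2 * d / 6], so the path stays within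
   [5 * d / 6] of [t]. *)
have gU x : I x -> U (g (z x)).
  move=> Ix; apply: dU => k; rewrite cg.
  have -> : crd a k + z x * (crd s k - crd a k) - crd t k =
    (crd a k - crd t k) + z x * (crd s k - crd a k) by ring.
  apply: le_lt_trans (ler_normD _ _) _; rewrite normrM.
  have [z2 _] := zI x Ix.
  apply: (@lt_le_trans _ _ (d / 6 + 2 * (d / 6 + d / 6))).
    by apply: ltr_leD; [apply: ta | apply: ler_pM].
  have -> : d / 6 + 2 * (d / 6 + d / 6) = d * (5 / 6) by field.
  by rewrite ler_piMr ?(ltW d0) // ler_pdivrMr // mul1r ler_nat.
have gnear x y d' : `|z y - z x| < d' / d -> near_row (g (z x)) d' (g (z y)).
  move=> zz k; rewrite !cg.
  have -> : crd a k + z y * (crd s k - crd a k) - (crd a k + z x * (crd s k - crd a k)) =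
    (z y - z x) * (crd s k - crd a k) by ring.
  rewrite normrM; apply: (@le_lt_trans _ _ (`|z y - z x| * d)).
    by rewrite ler_wpM2l.
  by rewrite -ltr_pdivlMr.
rewrite -g1 -z1; apply: (connected_sub (P := [set x | h (g (z x)) = 0]) cI) => //.
- by exists x0; rewrite //= z0 g0.
- move=> x Ix /= hx; have [_ qx] := zI x Ix; rewrite qE in qx.
  have [d' d'0 H] := zero_locally (gU x Ix) hx qx.
  have d'd : 0 < d' / d by rewrite divr_gt0.
  apply: filterS (zc x Ix _ d'd) => y zy Iy; apply: H; first exact: gU.
  exact: gnear.
- move=> x Ix /= /eqP hx; have [d' d'0 H] := nonzero_locally (gU x Ix) hx.
  have d'd : 0 < d' / d by rewrite divr_gt0.
  apply: filterS (zc x Ix _ d'd) => y zy _; apply/eqP/H; exact: gnear.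
Qed.

(** Both ends are perturbed off [c = 0]: [y] inside the open set where [h] vanishes, and [s], if
    [h s] were nonzero, inside the open set where [h] does not. *)
Lemma zero_on_ball t d y : 0 < d -> (forall u, near_row t d u -> U u) ->
  near_row t (d / 6) y -> (\forall u \near y, h u = 0) ->
  forall s, near_row t (d / 6) s -> h s = 0.
Proof.
move=> d0 dU ty hy s ts.
have d60 : 0 < d / 6 by rewrite divr_gt0.
have d6 : d / 6 <= d by rewrite ler_pdivrMr // ler_peMr ?(ltW d0) // ler1n.
have open_ball x : near_row t (d / 6) x -> nbhs x [set u | near_row t (d / 6) u].
  move=> tx; have : nbhs t (ball t (d / 6)) by apply: nbhsx_ballx.
  have ballE u : ball t (d / 6) u <-> near_row t (d / 6) u.
    split=> [b k|b]; first by have := b.2 ord0 k; rewrite /ball /= distrC.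
    split=> // i j; by rewrite ord1 /ball /= distrC; apply: b.
  move=> _; have : nbhs x (ball t (d / 6)).
    by apply: open_nbhs_nbhs; split; [apply: ball_open | apply/ballE].
  by apply: filterS => u /ballE.
have [a [ha ta] ca] := nbhs_mpoly_neq0 Q0 (filterI hy (open_ball y ty)).
apply/eqP; apply: contraT => hs.
have Us : U s by apply: dU; apply: near_row_le d6 ts.
have [d' d'0 H] := nonzero_locally Us hs.
have ns : nbhs s [set u | h u != 0] by apply/nbhs_near_row; exists d'.
have [s' [hs' ts'] cs'] := nbhs_mpoly_neq0 Q0 (filterI ns (open_ball s ts)).
by case/eqP: hs'; apply: (zero_along_path d0 dU ta ts' ca cs' ha).
Qed.

(** The points near which [h] vanishes form an open set. It is closed in [U], because one such point
    close to [x] makes [h] vanish on a ball around [x]. *)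
Lemma identity_principle t0 : U t0 -> (\forall u \near t0, h u = 0) ->
  forall t, U t -> h t = 0.
Proof.
move=> Ut0 ht0.
suff : U `<=` [set t | \forall u \near t, h u = 0].
  by move=> sub t /sub /nbhs_singleton.
apply: connected_sub connU _ _ _; first by exists t0.
  move=> x _ hx; have := nbhs_interior hx.
  by apply: filterS => y hy _.
move=> x Ux nx; have [d d0 dU] := (nbhs_near_row x U).1 (open_nbhs_nbhs (conj openU Ux)).
have d60 : 0 < d / 6 by rewrite divr_gt0.
apply/nbhs_near_row; exists (d / 6) => // y xy _ hy; apply: nx.
apply/nbhs_near_row; exists (d / 6) => //; exact: (zero_on_ball d0 dU xy hy).
Qed.

End Relation.

(** If [p] is nonzero at some point of the image, it is so nearby, where [q] must vanish; the
    identity principle spreads this to all of [U]. *)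
Lemma analytic_image_prime N (ph : 'rV[K^o]_n -> 'I_N -> K) :
  (forall t, U t -> forall k, cont_row t (fun u => ph u k)) ->
  (forall p : mpoly.mpoly N K, algebraic_over U crd (fun t => p.@[ph t])) ->
  forall p q, vanishes (p * q) (ph @` U) -> vanishes p (ph @` U) \/ vanishes q (ph @` U).
Proof.
move=> cph alg p q pq.
case: (pselect (vanishes p (ph @` U))) => [|np]; [by left | right].
have [t [Ut pt]] : exists t, U t /\ p.@[ph t] != 0.
  apply: contrapT => h; apply: np => _ [t Ut <-].
  by apply: contrapT => /eqP pt; apply: h; exists t.
have cp r u : U u -> cont_row u (fun v => r.@[ph v]).
  move=> Uu; apply: (eps_lim_mpoly (@near_row_le u) (F := fun k v => ph v k)) => k.
  exact: cph.
have [Q [mm Q0 QE]] := algebraic_over_unit_cst (alg q).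
have [d d0 H] := nonzero_locally (cp p) Ut pt.
have qt : \forall u \near t, q.@[ph u] = 0.
  have nU : nbhs t U by apply: open_nbhs_nbhs.
  have nd : nbhs t [set u | p.@[ph u] != 0] by apply/nbhs_near_row; exists d.
  apply: filterS (filterI nU nd) => u [Uu pu].
  have /eqP : (p * q).@[ph u] = 0 by apply: pq; exists u.
  by rewrite mpoly.mevalM mulf_eq0 (negPf pu) => /eqP.
move=> _ [u Uu <-].
exact: (identity_principle (h := fun v => q.@[ph v]) (cp q) Q0 QE Ut qt Uu).
Qed.

End Identity.

(** * Algebraic independence from the Jacobian *)

Section Tangent.
Variables (K : numFieldType).

(* [H (u, 0)] is the lowest homogeneous part of [G]. *)
Lemma lowest_form n (G : mpoly.mpoly n K) : G != 0 ->
  exists d (H : mpoly.mpoly n.+1 K), (exists u, H.@[ext_ord u 0] != 0) /\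
    forall s u, G.@[fun l => s * u l] = s ^+ d * H.@[ext_ord u s].
Proof.
move=> G0; pose w (i : 'I_n) := widen_ord (leqnSn n) i.
pose X i : mpoly.mpoly n.+1 K := mvar K i.
(* [P] is [G(s u)] as a polynomial in [u] and [s]; the largest power of [s] is factored out. *)
pose P := comp_fam (fun l => X (w l) * X ord_max) G.
have PE u s : P.@[ext_ord u s] = G.@[fun l => s * u l].
  rewrite comp_famE; apply: mpoly.meval_eq => l.
  by rewrite mpoly.mevalM !mpoly.mevalXU ext_ord_widen ext_ord_max mulrC.
have P0 : P != 0.
  have [u _ Gu] := mpoly_neq0_near (fun=> 0) G0 ltr01.
  apply: contraNneq Gu => P0; have := PE u 1; rewrite P0 mpoly.meval0 => ->.
  by apply/eqP/mpoly.meval_eq => l; rewrite mul1r.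
have [d [q + eq]] := multiplicity_XsubC (mpoly.muni P) 0.
rewrite muni_eq0 P0 /= => q0.
pose H := (map_poly (comp_fam (fun l => X (w l))) q).[X ord_max].
have HE u s : H.@[ext_ord u s] = (map_poly (mpoly.meval u) q).[s].
  rewrite meval_horner_comp mpoly.mevalXU ext_ord_max.
  congr (_.[_]); apply: eq_map_poly => r; apply: mpoly.meval_eq => l.
  by rewrite /evalf mpoly.mevalXU ext_ord_widen.
exists d, H; split=> [|s u].
  have [u _ qu] := mpoly_neq0_near (fun=> 0) q0 ltr01.
  by exists u; rewrite HE !horner_coef0 coef_map /= -horner_coef0.
rewrite -PE HE meval_muni eq subr0 rmorphM rmorphXn /= map_polyX.
by rewrite hornerM hornerXn mulrC.
Qed.

Variable n : nat.
Implicit Types (t : 'rV[K^o]_n).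

Lemma derive_row (h : 'rV[K^o]_n -> K^o) t (u : 'rV[K^o]_n) : differentiable h t ->
  'D_u h t = \sum_k u ord0 k * 'D_(delta_mx 0 k) h t.
Proof.
move=> dh; rewrite deriveE // {1}[u]row_sum_delta linear_sum /=.
by apply: eq_bigr => k _; rewrite linearZ /= deriveE.
Qed.

(* Differentiability at a single point suffices: a polynomial relation would force its
   lowest homogeneous part at [h t0] to vanish on the image of the differential. *)
Lemma tangent_alg_indep (h : 'I_n -> 'rV[K^o]_n -> K^o) t0 (U : set 'rV[K^o]_n) :
  nbhs t0 U -> (forall l, differentiable (h l) t0) ->
  (forall l k, 'D_(delta_mx 0 k) (h l) t0 = (l == k)%:R) ->
  alg_indep U (fun t l => h l t : K).
Proof.
move=> nU dh Dh G GU; apply/eqP; apply: contraT => G0.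
pose G' := comp_fam (fun l => mvar K l + mpoly.mpolyC n (h l t0 : K)) G.
have G'E y : G'.@[y] = G.@[fun l => y l + h l t0].
  by rewrite comp_famE; apply: mpoly.meval_eq => l; rewrite mpoly.mevalD mpoly.mevalC mpoly.mevalXU.
have G'0 : G' != 0.
  have [u _ Gu] := mpoly_neq0_near (fun=> 0) G0 ltr01.
  apply: contraNneq Gu => e.
  have := G'E (fun l => u l - h l t0); rewrite e mpoly.meval0 => ->.
  by apply/eqP/mpoly.meval_eq => l; rewrite subrK.
have [d [H [[u Hu] HG]]] := lowest_form G'0.
pose v : 'rV[K^o]_n := \row_k u k.
(* The difference quotient of [h l] along [v], which tends to [u l]. Since [h l] at [t0 + s v] is
   [h l t0 + s * F l s], the relation gives [s ^+ d * H(F(s), s) = 0] for small nonzero [s]. *)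
pose F l (s : K) : K := s^-1 * (h l (s *: v + t0) - h l t0).
pose N (d : K) (s : K) := s != 0 /\ `|s| < d.
have nle d1 d2 s : d1 <= d2 -> N d1 s -> N d2 s.
  by move=> le [s0 lt]; split=> //; apply: lt_le_trans le.
have limF l : eps_lim N (F l) (u l).
  have Dv : 'D_v (h l) t0 = u l.
    rewrite derive_row // (bigD1 l) //= Dh eqxx mulr1 mxE big1 ?addr0 // => k kl.
    by rewrite Dh eq_sym (negPf kl) mulr0.
  have cv : (fun s : K => s^-1 *: ((h l \o shift t0) (s *: v) - h l t0)) @ (0 : K^o)^'
      --> 'D_v (h l) t0.
    exact: diff_derivable.
  move=> e e0; move/cvgrPdist_lt: cv => /(_ _ e0) /nbhs_ballP [d' d'0 B].
  exists d' => // s [s0 sd]; rewrite -Dv distrC; apply: (B s) => //.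
  by rewrite /ball /= sub0r normrN.
have limH : eps_lim N (fun s => H.@[ext_ord (fun l => F l s) s]) H.@[ext_ord u 0].
  pose E (i : 'I_n.+1) (s : K) := ext_ord (fun l => F l s) s i.
  apply: (eps_lim_mpoly nle (F := E)) => i; rewrite /E /ext_ord; case: unlift => [l|].
    exact: limF.
  by move=> e e0; exists e => // s [_]; rewrite subr0.
have [d1 d10 B1] := eps_lim_neq0 limH Hu.
have [d2 d20 B2] : exists2 d2 : K, 0 < d2 & forall s : K, `|s| < d2 -> U (s *: v + t0).
  have [d2 d20 B] := (nbhs_near_row t0 U).1 nU.
  pose M := \sum_k `|u k| + 1.
  have M0 : 0 < M by rewrite ltr_wpDl // sumr_ge0.
  exists (d2 / M); first by rewrite divr_gt0.
  move=> s; rewrite ltr_pdivlMr // => sM; apply: B => k.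
  rewrite /crd !mxE addrK normrM; apply: le_lt_trans sM; rewrite ler_wpM2l //.
  by rewrite /M (bigD1 k) //= -addrA lerDl addr_ge0 // sumr_ge0.
have [d3 d30 /andP[l1 l2]] := exists_lower_bound2 d10 d20.
pose s := d3 / 2.
have s0 : 0 < s by rewrite divr_gt0.
have sn : `|s| < d3 by rewrite gtr0_norm // ltr_pdivrMr // ltr_pMr // ltr1n.
have := B1 s (conj (lt0r_neq0 s0) (lt_le_trans sn l1)).
suff -> : H.@[ext_ord (F^~ s) s] = 0 by rewrite normr0 le_gtF // divr_ge0.
have := HG s (F^~ s); rewrite G'E.
rewrite (mpoly.meval_eq _ (v2 := fun l => h l (s *: v + t0))).
  rewrite GU; last exact/B2/(lt_le_trans sn l2).
  by move/esym/eqP; rewrite mulf_eq0 expf_eq0 (gt_eqF s0) andbF /= => /eqP.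
by move=> l; rewrite /F mulrA divff ?lt0r_neq0 // mul1r subrK.
Qed.

Lemma differentiable_meval N (F : 'I_N -> 'rV[K^o]_n -> K^o) (p : mpoly.mpoly N K) t :
  (forall i, differentiable (F i) t) ->
  differentiable (fun u => p.@[fun i => F i u] : K^o) t.
Proof.
move=> dF.
have ext (f g : 'rV[K^o]_n -> K^o) : (forall u, g u = f u) ->
    differentiable f t -> differentiable g t.
  by move=> e; have -> : g = f by apply/funext.
elim/mpoly_ring_ind: p => [c|i|p q hp hq|p q hp hq].
- by apply: ext (differentiable_cst (c : K^o) t) => u; rewrite mpoly.mevalC.
- by apply: ext (dF i) => u; rewrite mpoly.mevalXU.
- by apply: ext (differentiableD hp hq) => u; rewrite mpoly.mevalD.
- by apply: ext (differentiableM hp hq) => u; rewrite mpoly.mevalM.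
Qed.

Lemma derive_lin_comb N (a : 'I_N -> K) (x : 'I_N -> 'rV[K^o]_n -> K^o) t v :
  (forall j, differentiable (x j) t) ->
  'D_v (fun u => \sum_j a j * x j u : K^o) t = \sum_j a j * 'D_v (x j) t.
Proof.
move=> dx; have -> : (fun u => \sum_j a j * x j u : K^o) = \sum_j (a j *: x j).
  by apply/funext => u; rewrite fct_sumE.
rewrite derive_sum => [|j]; last exact/derivableZ/diff_derivable.
by apply: eq_bigr => j _; rewrite deriveZ //; apply: diff_derivable.
Qed.

Lemma differentiable_cont_row (h : 'rV[K^o]_n -> K^o) t : differentiable h t ->
  cont_row t (h : _ -> K).
Proof.
move=> /differentiable_continuous ch e e0.
move/cvgrPdist_lt: ch => /(_ _ e0) /nbhs_near_row [d d0 B].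
by exists d => // u /B; rewrite distrC.
Qed.

End Tangent.

(** * Arcs avoiding the roots of a polynomial *)

Section Arc.
Variable (R : realType).

(** A parabolic arc from 0 to 1 as [tau] runs through the unit interval; [kappa] measures its
    bending. *)
Definition arc (kappa tau : R) : R[i] := Complex tau (kappa * (tau * (1 - tau))).

Lemma normc_le_sum (a b : R) : `|Complex a b| <= (`|a| + `|b|)%:C%C.
Proof.
rewrite normc_def lecR /= -[X in _ <= X]ger0_norm ?addr_ge0 // -sqrtr_sqr.
rewrite ler_wsqrtr // -(real_normK (num_real a)) -(real_normK (num_real b)).
by rewrite sqrrD lerD2r lerDl mulrn_wge0 // mulr_ge0.
Qed.

Lemma arc_bound kappa tau : 0 <= kappa <= 1 -> 0 <= tau <= 1 -> `|arc kappa tau| <= 2.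
Proof.
move=> /andP[k0 k1] /andP[t0 t1]; apply: le_trans (normc_le_sum _ _) _.
have -> : 2 = (2%:R : R)%:C%C by rewrite rmorph_nat.
have h1 : 0 <= tau * (1 - tau) by rewrite mulr_ge0 // subr_ge0.
rewrite lecR (ger0_norm t0) (ger0_norm (mulr_ge0 k0 h1)).
have h2 : tau * (1 - tau) <= 1 by nra.
have : kappa * (tau * (1 - tau)) <= 1 by nra.
lra.
Qed.

(** The imaginary part of the difference is [kappa * (1 - x - y) * (y - x)], with
    [|1 - x - y| <= 2]. The point [y] may lie outside the unit interval, as a neighbourhood of [x]
    requires. *)
Lemma arc_lipschitz kappa x y : 0 <= kappa <= 1 -> 0 <= x <= 1 -> `|y - x| < 1 ->
  `|arc kappa y - arc kappa x| <= (3 * `|y - x|)%:C%C.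
Proof.
move=> /andP[k0 k1] /andP[x0 x1] yx.
have -> : arc kappa y - arc kappa x = Complex (y - x) (kappa * (1 - x - y) * (y - x)).
  by rewrite /arc; apply/eqP; rewrite eq_complex /=; apply/andP; split; apply/eqP => //; ring.
apply: le_trans (normc_le_sum _ _) _; rewrite lecR.
have -> : 3 * `|y - x| = `|y - x| + 2 * `|y - x| by ring.
rewrite lerD2l normrM ler_wpM2r // normrM (ger0_norm k0).
have h : `|1 - x - y| <= 2.
  move: yx; rewrite ltr_norml ler_norml => /andP[h1 h2]; apply/andP; split; lra.
have h0 : 0 <= `|1 - x - y| by [].
by nra.
Qed.

(* Arcs with distinct [kappa] meet only at [0] and [1], so one of them misses the finitely
   many roots of [q]. *)
Lemma complex_avoiding_paths : has_avoiding_paths R[i].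
Proof.
move=> q q0 q1.
pose ka (j : nat) : R := j.+1%:R^-1.
have ka01 j : 0 <= ka j <= 1.
  by rewrite invr_ge0 ler0n invf_le1 ?ltr0n // ler1n.
have [j hj] : exists j, forall tau, 0 <= tau <= 1 -> q.[arc (ka j) tau] != 0.
  apply: contrapT => /forallNP h.
  have /choice [ta taP] : forall j, exists tau, 0 <= tau <= 1 /\ q.[arc (ka j) tau] = 0.
    move=> j; apply: contrapT => h'; apply: (h j) => tau t01.
    by apply/eqP => e; apply: h'; exists tau.
  (* Since [q] is nonzero at 0 and 1, the parameters avoid the endpoints, and [kappa] can be
     recovered from the point of the arc. *)
  have t0 j : ta j != 0.
    apply: contraNneq q0 => e; have e2 : arc (ka j) (ta j) = 0 by rewrite e /arc mul0r mulr0.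
    by have [_ /eqP] := taP j; rewrite e2.
  have t1 j : 1 - ta j != 0.
    apply: contraNneq q1 => /eqP; rewrite subr_eq0 eq_sym => /eqP e.
    have e2 : arc (ka j) (ta j) = 1 by rewrite e /arc subrr !mulr0.
    by have [_ /eqP] := taP j; rewrite e2.
  have inj : injective (fun j => arc (ka j) (ta j)).
    move=> i j [e1]; rewrite e1 => /(mulIf (mulf_neq0 (t0 j) (t1 j))) /invr_inj /eqP.
    by rewrite eqr_nat => /eqP [].
  have qn0 : q != 0 by apply: contraNneq q0 => ->; rewrite horner0.
  have := @max_poly_roots _ q [seq arc (ka j) (ta j) | j <- iota 0 (size q)] qn0.
  rewrite size_map size_iota ltnn map_inj_uniq // iota_uniq.
  suff -> : all (root q) [seq arc (ka j) (ta j) | j <- iota 0 (size q)] by move=> /(_ isT isT).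
  by apply/allP => _ /mapP [j _ ->]; apply/rootP; case: (taP j).
exists R, `[0, 1]%classic, (arc (ka j)), 0, 1; split.
- exact: segment_connected.
- by split; rewrite /= in_itv /= lexx ler01.
- by rewrite /arc subrr mul0r !mulr0.
- by move=> x; rewrite /= in_itv /= => x01; split; [apply: arc_bound | apply: hj].
move=> x; rewrite /= in_itv /= => x01 d d0.
(* Positivity in [R[i]] forces [d] to be real. *)
have dE : d = (complex.Re d)%:C%C.
  by move: d0; rewrite ltcE /= => /andP[/eqP e _]; apply/eqP; rewrite eq_complex /= eqxx e eqxx.
have rd0 : 0 < complex.Re d by move: d0; rewrite ltcE /= => /andP[].
have m0 : 0 < Num.min 1 (complex.Re d / 3) by rewrite lt_min ltr01 divr_gt0.
apply/nbhs_ballP; exists (Num.min 1 (complex.Re d / 3)) => //= y.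
rewrite /ball /= distrC lt_min => /andP[y1 y2].
apply: le_lt_trans (arc_lipschitz (ka01 j) x01 y1) _.
by rewrite dE ltcR mulrC -ltr_pdivlMr.
Qed.

End Arc.

End AnalyticPart.

(** * Dimension and irreducibility of the auxiliary, incidence and radical varieties *)

Import AlgebraicPart AnalyticPart.

Theorem theorem3p11 (R : realType) (n m r : nat)
  (e : 'I_m -> nat)
  (aN aD : forall i : 'I_m, mpoly.mpoly (n + i) R[i])
  (xN xD : 'I_r -> mpoly.mpoly (n + m) R[i])
  (U : set 'rV[R[i]^o]_n) (delta : 'I_m -> 'rV[R[i]^o]_n -> R[i])
  (L : mpoly.mpoly (n + m + r + 1) R[i]) :
  (n < r)%N ->
  (forall i, (0 < e i)%N) ->
  branch_realization R n m r e aN aD xD U delta ->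
  (exists2 t0, U t0 & \rank (xjacobian R n m r xN xD delta t0) = n) ->
  is_lcm R[i] (n + m + r + 1) (denominators R n m r aD xD) L ->
  [/\ (forall Z, zcomponent R[i] (n + m + r) (auxiliary_variety R n m r e aN aD xN xD L) Z ->
                  zdim R[i] (n + m + r) Z n),
      zirreducible R[i] (n + m + r) (incidence_variety R n m r xN xD U delta) /\
        zdim R[i] (n + m + r) (incidence_variety R n m r xN xD U delta) n &
      zirreducible R[i] r (radical_variety R n m r xN xD U delta) /\
        zdim R[i] r (radical_variety R n m r xN xD U delta) n].
Proof.
move=> _ e_gt0 br [t0 Ut0 rkJ] lcmL.
have [openU connU _ hol brU] := br.
pose locus := @regular_locus R[i] n m r e aN aD xN xD.
have auxE : auxiliary_variety R n m r e aN aD xN xD L = zclosure locus.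
  have E := @projection_equations R[i] n m r e aN aD xN xD L lcmL.
  exact: (congr1 (@zclosure R[i] (n + m + r)) E).
have dimA Z : zcomponent R[i] (n + m + r) (auxiliary_variety R n m r e aN aD xN xD L) Z ->
    zdim R[i] (n + m + r) Z n.
  rewrite auxE => cZ; have [irrZ subZ _] := cZ.
  exact: (zdim_sub_locus e_gt0 irrZ subZ (zcomponent_locus_alg_indep e_gt0 cZ)).
pose ph := phi xN xD delta.
have phE t b : ph t (lshift r b) = tdpoint t (fun i => delta i t) b.
  by rewrite /ph /phi (unsplitK (inl b)).
have phX t j : ph t (rshift (n + m) j) = xfun xN xD delta j t.
  by rewrite /ph /phi (unsplitK (inr j)).
have phT t : t_part (ph t) = crd t.
  by apply/funext => k; rewrite /t_part phE /tdpoint (unsplitK (inl k)).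
have phL t : U t -> locus (ph t).
  move=> Ut; have [h1 h2 h3] := brU t Ut.
  have tdE : td_part (ph t) = tdpoint t (fun i => delta i t).
    by apply/funext => b; apply: phE.
  split=> [i _|j]; rewrite tdE.
    split; first exact: h1.
    by rewrite /tdpoint (unsplitK (inr i)) h2 divfK //; apply: h1.
  split; first exact: h3.
  by rewrite phX /xfun divfK //; apply: h3.
have dtd t b : U t ->
    differentiable (fun u => tdpoint u (fun i => delta i u) b : R[i]^o) t.
  move=> Ut; rewrite /tdpoint; case: (fintype.split b) => [k|i].
    exact: differentiable_coord.
  exact: hol.
have dx t j : U t -> differentiable (xfun xN xD delta j : _ -> R[i]^o) t.
  move=> Ut; have [_ _ h3] := brU t Ut.
  have dv p := @differentiable_meval R[i] n (n + m)
    (fun b u => tdpoint u (fun i => delta i u) b) p t (fun b => dtd t b Ut).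
  exact: (differentiableM (dv (xN j)) (differentiableV (dv (xD j)) (h3 j))).
have cph t : U t -> forall k, cont_row t (fun u => ph u k).
  move=> Ut k; apply: differentiable_cont_row; rewrite /ph /phi.
  by case: (fintype.split k) => [b|j]; [apply: dtd | apply: dx].
(* A relation over [T] on the locus pulls back along [ph] to a relation over [t] on [U]. *)
have alg p : algebraic_over U (@crd R[i] n) (fun t => mpoly.meval (ph t) p).
  have [Q Q0 QE] := meval_algebraic_over_locus aN aD xN xD e_gt0 p.
  exists Q => // t Ut; have := QE _ (phL t Ut).
  by rewrite evalf_tvar phT.
set B := incidence_variety R n m r xN xD U delta.
have irrB : zirreducible R[i] (n + m + r) B.
  apply: zirreducible_closure; first by exists (ph t0), t0.
  exact: (analytic_image_prime (@complex_avoiding_paths R) openU connU cph alg).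
have subB : B `<=` zclosure locus.
  apply: zclosureS; first exact: zclosure_closed.
  by move=> _ [t Ut <-]; apply: subset_zclosure; apply: phL.
have nU : nbhs t0 U by apply: open_nbhs_nbhs.
(* [T] takes all values of the open set [U] on the image, and no nonzero polynomial vanishes on
   [U]. *)
have indB : alg_indep B (evalf (@tvar R[i] n m r)).
  move=> q qB; apply/eqP; apply: contraT => q0.
  have [t Ut /eqP qt] := nbhs_mpoly_neq0 q0 nU; case: qt.
  have Bt : B (ph t) by apply: subset_zclosure; exists t.
  by have := qB _ Bt; rewrite evalf_tvar phT.
have dimB := zdim_sub_locus e_gt0 irrB subB indB.
(* Rank [n] gives a left inverse [A] of the Jacobian; its rows are the coefficients of the linear
   forms [F]. *)
have /row_fullP [A AJ] : row_full (xjacobian R n m r xN xD delta t0).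
  by rewrite /row_full rkJ.
pose F (l : 'I_n) : mpoly.mpoly r R[i] := \sum_j A l j *: mvar R[i] j.
have FE l w : mpoly.meval w (F l) = \sum_j A l j * w j.
  rewrite raddf_sum /=; apply: eq_bigr => j _.
  by rewrite mpoly.mevalZ mpoly.mevalXU.
pose h (l : 'I_n) : 'rV[R[i]^o]_n -> R[i]^o :=
  fun t => mpoly.meval (fun j => xfun xN xD delta j t) (F l).
have dh l : differentiable (h l) t0.
  exact: (@differentiable_meval R[i] n r (fun j => xfun xN xD delta j) (F l) t0
    (fun j => dx t0 j Ut0)).
have Dh l k : 'D_(delta_mx 0 k) (h l) t0 = (l == k)%:R.
  have -> : h l = fun t => \sum_j A l j * xfun xN xD delta j t by apply/funext => t; apply: FE.
  rewrite derive_lin_comb => [|j]; last exact: dx.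
  by move/matrixP: AJ => /(_ l k); rewrite !mxE => <-; apply: eq_bigr => j _; rewrite mxE.
have indV : alg_indep (@coord_x R[i] n m r @` B) (evalf F).
  move=> q qB; apply: (tangent_alg_indep nU dh Dh) => t Ut.
  have Bt : B (ph t) by apply: subset_zclosure; exists t.
  have := qB (coord_x (ph t)) (ex_intro2 _ _ _ Bt erefl).
  suff -> : evalf F (coord_x (ph t)) = fun l => h l t by [].
  apply/funext => l; rewrite /evalf /h !FE.
  by apply: eq_bigr => j _; rewrite /coord_x phX.
by split=> //; apply: (zdim_projection e_gt0 irrB subB indB indV).
Qed.
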